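(* Let $G=\mathrm{Mon}(n,\mathbb{F})\le\mathrm{GL}(n,\mathbb{F})$ be the monomial subgroup. There exists a polynomial-time computable function $f:\mathrm{T}(n\times m\times\ell,\mathbb{F})\to\mathrm{T}(n'\times m'\times\ell',\mathbb{F})$ such that $\mathtt{A},\mathtt{B}\in\mathrm{T}(n\times m\times\ell,\mathbb{F})$ are isomorphic under $G\times\mathrm{GL}(m,\mathbb{F})\times\mathrm{GL}(\ell,\mathbb{F})$ if and only if $f(\mathtt{A})$ and $f(\mathtt{B})$ are isomorphic as plain tensors (under $\mathrm{GL}(n')\times\mathrm{GL}(m')\times\mathrm{GL}(\ell')$); moreover $n',m',\ell'=O(n+m+\ell)$. The same holds for $G=\mathrm{diag}(n,\mathbb{F})$, the group of invertible diagonal matrices, when $f$ is instead a Las Vegas randomized polynomial-time computable function.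
   Context: $\mathrm{T}(n\times m\times\ell,\mathbb{F})$ is the space of $n\times m\times\ell$ arrays $(a_{i,j,k})$ over $\mathbb{F}$; $(R,S,T)\in\mathrm{GL}(n)\times\mathrm{GL}(m)\times\mathrm{GL}(\ell)$ acts by $a'_{i,j,k}=\sum_{i',j',k'}r_{i,i'}s_{j,j'}t_{k,k'}a_{i',j',k'}$. $\mathtt{A},\mathtt{B}$ are isomorphic under a subgroup $K$ if some element of $K$ sends $\mathtt{A}$ to $\mathtt{B}$. $\mathrm{Mon}(n,\mathbb{F})$ consists of invertible matrices with exactly one nonzero entry in each row and column. *)

(* Defs.v *)
From HB Require Import structures.
From mathcomp Require Import all_boot all_order all_algebra.

Set Implicit Arguments.
Unset Strict Implicit.
Unset Printing Implicit Defensive.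

Import GRing.Theory.

(** * Tensors and isomorphism under a group *)

Definition tensor (F : fieldType) (n m l : nat) : Type :=
  {ffun 'I_n * 'I_m * 'I_l -> F}.

Section Action.
Variables (F : fieldType) (n m l : nat).
Local Open Scope ring_scope.

Definition tensor_act (R : 'M[F]_n) (S : 'M[F]_m) (T : 'M[F]_l)
    (A : tensor F n m l) : tensor F n m l :=
  [ffun x : 'I_n * 'I_m * 'I_l =>
     \sum_(i' < n) \sum_(j' < m) \sum_(k' < l)
        R x.1.1 i' * S x.1.2 j' * T x.2 k' * A (i', j', k')].

(** [G], [H], [K] are the subgroups, given as sets of matrices. *)
Definition tensor_isomorphic (G : pred 'M[F]_n) (H : pred 'M[F]_m)
    (K : pred 'M[F]_l) (A B : tensor F n m l) : Prop :=
  exists (R : 'M[F]_n) (S : 'M[F]_m) (T : 'M[F]_l),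
    [/\ G R, H S, K T & tensor_act R S T A = B].

Definition GL : pred 'M[F]_n := fun M => M \in unitmx.

Definition Mon : pred 'M[F]_n := fun M =>
  [&& M \in unitmx,
      [forall i, #|[set j | M i j != 0]| == 1%N]
    & [forall j, #|[set i | M i j != 0]| == 1%N]].

Definition Diag : pred 'M[F]_n := fun M => (M \in unitmx) && is_diag_mx M.

End Action.

Arguments GL F n : clear implicits.
Arguments Mon F n : clear implicits.
Arguments Diag F n : clear implicits.

(** A family of maps on the tensor spaces of all formats [n x m x l] at once;
    the format of the image depends only on [n], [m], [l]. *)
Definition tensor_map (F : fieldType) (n' m' l' : nat -> nat -> nat -> nat) :=
  forall n m l : nat,
    tensor F n m l -> tensor F (n' n m l) (m' n m l) (l' n m l).

Definition linearly_bounded (g : nat -> nat -> nat -> nat) : Prop :=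
  exists C : nat, forall n m l : nat,
    0 < n + m + l -> g n m l <= C * (n + m + l).

(** * Computation over a field

    Programs for a random access machine over [F], in the style of
    Blum-Shub-Smale: natural-number registers, and arrays of field elements
    that are addressed by natural numbers.  Every expression is charged, at
    each node, for the length of the value it produces: the binary length for a
    natural number, and [1 + sz x] for a field element [x].  The parameter [sz]
    fixes the cost model over [F]: [sz = 0] charges one unit per field
    operation (the algebraic model), while taking for [sz] the length of a
    binary encoding of the elements (of a finite field, of a number field)
    charges for bit operations. *)

Inductive nexp : Type :=
  | NConst of nat
  | NReg of nat
  | NAdd of nexp & nexp
  | NSub of nexp & nexp
  | NMul of nexp & nexp
  | NDiv of nexp & nexp
  | NMod of nexp & nexp.

Inductive fexp (F : Type) : Type :=
  | FConst of F
  | FLoad of nat & nexp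
  | FOpp of fexp F
  | FAdd of fexp F & fexp F
  | FMul of fexp F & fexp F
  | FInv of fexp F.

Inductive bexp (F : Type) : Type :=
  | BLeq of nexp & nexp
  | BEqF of fexp F & fexp F
  | BNot of bexp F
  | BAnd of bexp F & bexp F.

Arguments BLeq {F} _ _.
Arguments FLoad {F} _ _.

(** [Flip x] moves the next random bit into register [x]. *)
Inductive cmd (F : Type) : Type :=
  | Skip
  | NSet of nat & nexp
  | FSet of nat & nexp & fexp F
  | Flip of nat
  | Seq of cmd F & cmd F
  | If of bexp F & cmd F & cmd F
  | While of bexp F & cmd F.

Arguments Skip {F}.
Arguments NSet {F} _ _.
Arguments Flip {F} _.

(** [fmem s a p] is cell [p] of array [a]; [coins s] are the unread random
    bits. *)
Record state (F : Type) : Type := State {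
  nreg : nat -> nat;
  fmem : nat -> nat -> F;
  coins : seq bool
}.

Section Semantics.
Variables (F : fieldType) (sz : F -> nat).
Implicit Type s : state F.

Definition set_nreg s (x v : nat) : state F :=
  State (fun y => if y == x then v else nreg s y) (fmem s) (coins s).

Definition set_fmem s (a p : nat) (v : F) : state F :=
  State (nreg s)
    (fun b q => if (b == a) && (q == p) then v else fmem s b q) (coins s).

Definition set_coins s (w : seq bool) : state F := State (nreg s) (fmem s) w.

Definition nat_len (v : nat) : nat := (trunc_log 2 v).+1.

Fixpoint neval s (e : nexp) : nat :=
  match e with
  | NConst v => v
  | NReg x => nreg s x
  | NAdd e1 e2 => neval s e1 + neval s e2
  | NSub e1 e2 => neval s e1 - neval s e2
  | NMul e1 e2 => neval s e1 * neval s e2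
  | NDiv e1 e2 => neval s e1 %/ neval s e2
  | NMod e1 e2 => neval s e1 %% neval s e2
  end.

Fixpoint ncost s (e : nexp) : nat :=
  nat_len (neval s e) +
  match e with
  | NConst _ | NReg _ => 0
  | NAdd e1 e2 | NSub e1 e2 | NMul e1 e2 | NDiv e1 e2 | NMod e1 e2 =>
      ncost s e1 + ncost s e2
  end.

Fixpoint feval s (e : fexp F) : F :=
  match e with
  | FConst c => c
  | FLoad a p => fmem s a (neval s p)
  | FOpp e1 => - feval s e1
  | FAdd e1 e2 => feval s e1 + feval s e2
  | FMul e1 e2 => feval s e1 * feval s e2
  | FInv e1 => (feval s e1)^-1
  end%R.

Fixpoint fcost s (e : fexp F) : nat :=
  (sz (feval s e)).+1 +
  match e with
  | FConst _ => 0
  | FLoad _ p => ncost s p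
  | FOpp e1 | FInv e1 => fcost s e1
  | FAdd e1 e2 | FMul e1 e2 => fcost s e1 + fcost s e2
  end.

Fixpoint beval s (b : bexp F) : bool :=
  match b with
  | BLeq e1 e2 => neval s e1 <= neval s e2
  | BEqF e1 e2 => feval s e1 == feval s e2
  | BNot b1 => ~~ beval s b1
  | BAnd b1 b2 => beval s b1 && beval s b2
  end.

Fixpoint bcost s (b : bexp F) : nat :=
  1 + match b with
      | BLeq e1 e2 => ncost s e1 + ncost s e2
      | BEqF e1 e2 => fcost s e1 + fcost s e2
      | BNot b1 => bcost s b1
      | BAnd b1 b2 => bcost s b1 + bcost s b2
      end.

(** [exec c s t s']: started in [s], the program [c] halts in state [s'] after
    time [t].  A [Flip] with no random bit left is stuck. *)
Inductive exec : cmd F -> state F -> nat -> state F -> Prop :=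
  | exec_Skip s : exec Skip s 1 s
  | exec_NSet s x e :
      exec (NSet x e) s (ncost s e).+1 (set_nreg s x (neval s e))
  | exec_FSet s a p e :
      exec (FSet a p e) s (ncost s p + fcost s e).+1
        (set_fmem s a (neval s p) (feval s e))
  | exec_Flip s x b w :
      coins s = b :: w ->
      exec (Flip x) s 1 (set_nreg (set_coins s w) x (nat_of_bool b))
  | exec_Seq c1 c2 s s1 s2 t1 t2 :
      exec c1 s t1 s1 -> exec c2 s1 t2 s2 -> exec (Seq c1 c2) s (t1 + t2) s2
  | exec_If_true b c1 c2 s t s' :
      beval s b -> exec c1 s t s' -> exec (If b c1 c2) s (bcost s b + t) s'
  | exec_If_false b c1 c2 s t s' :
      ~~ beval s b -> exec c2 s t s' -> exec (If b c1 c2) s (bcost s b + t) s'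
  | exec_While_false b c s :
      ~~ beval s b -> exec (While b c) s (bcost s b) s
  | exec_While_true b c s s1 s2 t1 t2 :
      beval s b -> exec c s t1 s1 -> exec (While b c) s1 t2 s2 ->
      exec (While b c) s (bcost s b + t1 + t2) s2.

Lemma exec_functional c s t1 s1 t2 s2 :
  exec c s t1 s1 -> exec c s t2 s2 -> t1 = t2 /\ s1 = s2.
Proof.
move=> H; elim: H t2 s2 => {c s t1 s1}.
- by move=> s t2 s2 H; inversion H.
- by move=> s x e t2 s2 H; inversion H.
- by move=> s a p e t2 s2 H; inversion H.
- move=> s x b w Hw t2 s2 H; inversion H as [| | |s' x' b' w' Hw'| | | | |].
  by move: Hw'; rewrite Hw => -[-> ->].
- move=> c1 c2 s s1 s2 t1 t2 _ IH1 _ IH2 t3 s3 H.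
  inversion H as [| | | |c1' c2' s' s4 s5 t4 t5 H1 H2| | | |]; subst.
  by have [-> E] := IH1 _ _ H1; rewrite -E in H2; have [-> ->] := IH2 _ _ H2.
- move=> b c1 c2 s t s' Hb _ IH t2 s2 H.
  inversion H as [| | | | |b' c1' c2' s0 t' s0' Hb' H'|b' c1' c2' s0 t' s0' Hb' H'| |]; subst.
    by have [-> ->] := IH _ _ H'.
  by rewrite Hb in Hb'.
- move=> b c1 c2 s t s' Hb _ IH t2 s2 H.
  inversion H as [| | | | |b' c1' c2' s0 t' s0' Hb' H'|b' c1' c2' s0 t' s0' Hb' H'| |]; subst.
    by rewrite Hb' in Hb.
  by have [-> ->] := IH _ _ H'.
- move=> b c s Hb t2 s2 H.
  inversion H as [| | | | | | |b' c' s' Hb'|b' c' s' s3 s4 t3 t4 Hb']; subst => //.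
  by rewrite Hb' in Hb.
- move=> b c s s1 s2 t1 t2 Hb _ IH1 _ IH2 t3 s3 H.
  inversion H as [| | | | | | |b' c' s' Hb'|b' c' s' s4 s5 t4 t5 Hb' H1 H2]; subst.
    by rewrite Hb in Hb'.
  by have [-> E] := IH1 _ _ H1; rewrite -E in H2; have [-> ->] := IH2 _ _ H2.
Qed.

(** Tensors are stored in row-major order. *)
Definition tensor_addr (n m l : nat) (x : 'I_n * 'I_m * 'I_l) : nat :=
  (x.1.1 * m + x.1.2) * l + x.2.

(** Input: the format in registers 0, 1, 2 and the entries in array 0; all other
    registers and cells are 0; [w] is the supply of random bits. *)
Definition init_state (n m l : nat) (A : tensor F n m l) (w : seq bool) :
    state F :=
  State (nth 0 [:: n; m; l])
    (fun a p =>
       if a == 0 then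
         if [pick x | tensor_addr x == p] is Some x then A x else 0%R
       else 0%R)
    w.

(** Output: the format in registers 0, 1, 2 and the entries in array 1. *)
Definition outputs (n m l : nat) (s : state F) (B : tensor F n m l) : Prop :=
  [/\ nreg s 0 = n, nreg s 1 = m, nreg s 2 = l
    & forall x, fmem s 1 (tensor_addr x) = B x].

(** Register 3 is the flag by which a randomized program reports failure. *)
Definition reports_failure (s : state F) : bool := nreg s 3 != 0.

Definition input_size (n m l : nat) (A : tensor F n m l) : nat :=
  n + m + l + \sum_x (sz (A x)).+1.

(** The initial state has no random bits, so no [Flip] is ever executed. *)
Definition polytime_computable (n' m' l' : nat -> nat -> nat -> nat)
    (f : tensor_map F n' m' l') : Prop :=
  exists (p : cmd F) (c d : nat), forall (n m l : nat) (A : tensor F n m l),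
    exists (t : nat) (s : state F),
      [/\ exec p (init_state A [::]) t s,
          t <= c * (input_size A).+1 ^ d
        & outputs s (f n m l A)].

(** Zero-error randomized polynomial time: whatever the random bits, the program
    halts in polynomial time [T] and either outputs the value of [f] or reports
    failure; the latter happens with probability at most 1/2.  As a [Flip] costs
    one unit of time, at most [T] random bits are read. *)
Definition las_vegas_polytime_computable (n' m' l' : nat -> nat -> nat -> nat)
    (f : tensor_map F n' m' l') : Prop :=
  exists (p : cmd F) (c d : nat), forall (n m l : nat) (A : tensor F n m l),
    let T := c * (input_size A).+1 ^ d in
    exists good : {set T.-tuple bool},
      2 ^ T <= 2 * #|good| /\
      forall w : T.-tuple bool, exists (t : nat) (s : state F),
        [/\ exec p (init_state A w) t s,
            t <= T
          & if w \in good then ~~ reports_failure s /\ outputs s (f n m l A)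
            else reports_failure s].

End Semantics.

(* Main.v *)
(* Write a tensor as the tuple of its first-index slices, and let [C] be a fixed
   [u]-tuple of [v x v] matrices.  The image of [A] has the slices
       [ A_p  0    0 ]                      [ 0  0  I ]
       [ 0    C_p  0 ]  (p < u)    and      [ 0  0  0 ],
   where [A_p] is padded with zero rows and [I] is large.  An element of the span
   of the slices has small rank exactly if it does not involve the last slice,
   and the last slice is, up to scalars, the only element of minimal rank among
   the others; so an isomorphism respects it.  Comparing blocks then shows that
   the isomorphism acts on the first index as an automorphism of [C] while
   carrying [A] to [B], by matrices that may be singular because of the padding
   but can be replaced by invertible ones.

   For [C] the unit tensor, the automorphisms act on the first index by monomial
   matrices.  Adding to [C] a slice with a nilpotent shift matrix leaves only
   the diagonal ones, since a directed path has no nontrivial automorphism; this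
   needs no random choices. *)
Require Import Defs.
From mathcomp Require Import all_boot all_order all_algebra.
From mathcomp Require Import zify.

Set Implicit Arguments.
Unset Strict Implicit.
Unset Printing Implicit Defensive.

Import GRing.Theory.

(** * Families of matrices *)

Section MatrixFamilies.
Local Open Scope ring_scope.
Variable F : fieldType.

Definition lincomb u a b (N : 'I_u -> 'M[F]_(a, b)) (y : 'rV_u) : 'M_(a, b) :=
  \sum_j y 0 j *: N j.

(** The three matrices may be singular: cutting off the padding later leaves transformations whose
    invertibility has to be restored. *)
Definition family_eqv u a b (R : 'M[F]_u) (S : 'M_a) (T : 'M_b)
    (N N' : 'I_u -> 'M[F]_(a, b)) : Prop :=
  forall i, N' i = S *m lincomb N (row i R) *m T^T.

Lemma lincomb0 u a b (N : 'I_u -> 'M_(a, b)) : lincomb N 0 = 0.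
Proof. by apply: big1 => j _; rewrite mxE scale0r. Qed.

Lemma lincomb_delta u a b (N : 'I_u -> 'M_(a, b)) i :
  lincomb N (delta_mx 0 i) = N i.
Proof.
rewrite /lincomb (bigD1 i) //= mxE !eqxx scale1r big1 ?addr0 // => j ji.
by rewrite mxE (negPf ji) andbF scale0r.
Qed.

Lemma lincomb_row1 u a b (N : 'I_u -> 'M_(a, b)) i :
  lincomb N (row i 1%:M) = N i.
Proof. by rewrite row1 lincomb_delta. Qed.

Lemma lincomb_mulmx u a b (N : 'I_u -> 'M_(a, b)) w (y : 'rV_w) (R : 'M_(w, u)) :
  lincomb N (y *m R) = \sum_i y 0 i *: lincomb N (row i R).
Proof.
rewrite /lincomb (eq_bigr (fun i => \sum_j (y 0 i * R i j) *: N j)); last first.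
  by move=> i _; rewrite scaler_sumr; apply: eq_bigr => j _; rewrite mxE scalerA.
by rewrite exchange_big; apply: eq_bigr => j _; rewrite mxE scaler_suml.
Qed.

Lemma lincomb_block u a b c d (A : 'I_u -> 'M_(a, b)) (B : 'I_u -> 'M_(a, c))
    (C : 'I_u -> 'M_(d, b)) (D : 'I_u -> 'M_(d, c)) y :
  lincomb (fun i => block_mx (A i) (B i) (C i) (D i)) y =
  block_mx (lincomb A y) (lincomb B y) (lincomb C y) (lincomb D y).
Proof.
apply/matrixP => i j; rewrite summxE.
case: (split_ordP i) => i' ->; case: (split_ordP j) => j' ->;
  by rewrite ?(block_mxEul, block_mxEur, block_mxEdl, block_mxEdr) summxE;
     apply: eq_bigr => p _; rewrite [LHS]mxE [RHS]mxE ?(block_mxEul, block_mxEur, block_mxEdl, block_mxEdr).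
Qed.

Lemma lincomb_row_mx u a b c (A : 'I_u -> 'M_(a, b)) (B : 'I_u -> 'M_(a, c)) y :
  lincomb (fun i => row_mx (A i) (B i)) y = row_mx (lincomb A y) (lincomb B y).
Proof.
apply/matrixP => i j; rewrite summxE.
by case: (split_ordP j) => j' ->; rewrite ?(row_mxEl, row_mxEr) summxE;
   apply: eq_bigr => p _; rewrite [LHS]mxE [RHS]mxE ?(row_mxEl, row_mxEr).
Qed.

Lemma lincomb_col_mx u a b c (A : 'I_u -> 'M_(a, b)) (B : 'I_u -> 'M_(c, b)) y :
  lincomb (fun i => col_mx (A i) (B i)) y = col_mx (lincomb A y) (lincomb B y).
Proof.
apply/matrixP => i j; rewrite summxE.
by case: (split_ordP i) => i' ->; rewrite ?(col_mxEu, col_mxEd) summxE;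
   apply: eq_bigr => p _; rewrite [LHS]mxE [RHS]mxE ?(col_mxEu, col_mxEd).
Qed.

Lemma lincomb_cst0 u a b y : lincomb (fun _ : 'I_u => 0 : 'M_(a, b)) y = 0.
Proof. by apply: big1 => j _; rewrite scaler0. Qed.

Lemma family_eqv_lincomb u a b (R : 'M_u) (S : 'M_a) (T : 'M_b)
    (N N' : 'I_u -> 'M_(a, b)) :
  family_eqv R S T N N' ->
  forall y, lincomb N' y = S *m lincomb N (y *m R) *m T^T.
Proof.
move=> E y; rewrite lincomb_mulmx mulmx_sumr mulmx_suml.
by apply: eq_bigr => i _; rewrite E -scalemxAr -scalemxAl.
Qed.

Lemma family_eqvV u a b (R : 'M_u) (S : 'M_a) (T : 'M_b)
    (N N' : 'I_u -> 'M_(a, b)) :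
  R \in unitmx -> S \in unitmx -> T \in unitmx -> family_eqv R S T N N' ->
  family_eqv (invmx R) (invmx S) (invmx T) N' N.
Proof.
move=> uR uS uT E i.
rewrite (family_eqv_lincomb E) -row_mul mulVmx // lincomb_row1.
by rewrite !mulmxA mulVmx // mul1mx -mulmxA -trmx_mul mulVmx // trmx1 mulmx1.
Qed.

(** Summation over the first index is a linear combination of slices; summation over the other two
    is multiplication by [S] on the left and [T^T] on the right. *)
Lemma tensor_act_slices n m l (R : 'M[F]_n) (S : 'M_m) (T : 'M_l)
    (A B : tensor F n m l) :
  tensor_act R S T A = B <->
  family_eqv R S T (fun i => \matrix_(j, k) A (i, j, k))
                   (fun i => \matrix_(j, k) B (i, j, k)).
Proof.
have E i j k : tensor_act R S T A (i, j, k) =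
    (S *m lincomb (fun i => \matrix_(j, k) A (i, j, k)) (row i R) *m T^T) j k.
  rewrite ffunE /= /lincomb mulmx_sumr mulmx_suml summxE; apply: eq_bigr => i' _.
  rewrite -scalemxAr -scalemxAl !mxE exchange_big mulr_sumr; apply: eq_bigr => k' _ /=.
  rewrite !mxE mulr_suml mulr_sumr; apply: eq_bigr => j' _.
  by rewrite !mxE -!mulrA; congr (_ * (_ * _)); rewrite mulrC.
split=> [<- i|EB]; first by apply/matrixP => j k; rewrite mxE E.
by apply/ffunP => -[[i j] k]; rewrite E -EB mxE.
Qed.

(** * Completing singular transformations *)

(* If each of two families is obtained from the other by possibly singular
   transformations, their joint column spaces have equal dimension, so the
   transformation is injective on the relevant space and extends to a unit. *)
Lemma complete_left u a b (R R' : 'M[F]_u) (S S' : 'M_a) (T T' : 'M_b)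
    (N N' : 'I_u -> 'M_(a, b)) :
  family_eqv R S T N N' -> family_eqv R' S' T' N' N ->
  exists2 S1 : 'M_a, S1 \in unitmx & family_eqv R S1 T N N'.
Proof.
(* The row space of [D K] is the joint column space of the family [K], transposed. *)
pose D (K : 'I_u -> 'M[F]_(a, b)) := (\sum_i <<(K i)^T>>)%MS.
have DK K y : ((lincomb K y)^T <= D K)%MS.
  rewrite /lincomb linear_sum; apply: summx_sub => j _.
  by rewrite linearZ /= scalemx_sub // (sumsmx_sup j) // genmxE.
have DM R0 (S0 : 'M_a) (T0 : 'M_b) K K' :
    family_eqv R0 S0 T0 K K' -> (D K' <= D K *m S0^T)%MS.
  move=> E; apply/sumsmx_subP => i _; rewrite genmxE E !trmx_mul trmxK.
  by rewrite mulmx_sub // submxMr.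
move=> E E'.
(* The ranks of [D N], [D N'], [D N *m S^T], [D N] increase weakly in this order, so they all
   agree. *)
have rk : \rank (D N *m S^T) = \rank (D N).
  apply/eqP; rewrite eqn_leq mxrankM_maxl /=.
  apply: leq_trans (mxrankS (DM _ _ _ _ _ E)).
  by apply: leq_trans (mxrankS (DM _ _ _ _ _ E')) (mxrankM_maxl _ _).
(* A map that preserves the rank of a space agrees on it with some unit, and every transposed
   combination of [N] lies in this space. *)
have [g ug Eg] := complete_unitmx rk.
exists g^T; rewrite ?unitmx_tr // => i; rewrite E; congr (_ *m _).
apply: trmx_inj; rewrite !trmx_mul trmxK.
by have /submxP [X ->] := DK N (row i R); rewrite -!mulmxA Eg.
Qed.

Lemma family_eqv_tr u a b (R : 'M[F]_u) (S : 'M_a) (T : 'M_b)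
    (N N' : 'I_u -> 'M_(a, b)) :
  family_eqv R S T N N' -> family_eqv R T S (fun i => (N i)^T) (fun i => (N' i)^T).
Proof.
move=> E i; rewrite E !trmx_mul trmxK mulmxA; congr (_ *m _ *m _).
by rewrite /lincomb linear_sum; apply: eq_bigr => j _; rewrite linearZ.
Qed.

(** [complete_left] is used twice, the second time on the transposed families and starting from the
    completed [S1]. The relation back from [N'] need not be inverse to the given one. *)
Lemma complete_units u a b (R R' : 'M[F]_u) (S S' : 'M_a) (T T' : 'M_b)
    (N N' : 'I_u -> 'M_(a, b)) :
  family_eqv R S T N N' -> family_eqv R' S' T' N' N ->
  exists S1 T1, [/\ S1 \in unitmx, T1 \in unitmx & family_eqv R S1 T1 N N'].
Proof.
move=> E E'; have [S1 uS1 E1] := complete_left E E'.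
have [T1 uT1 E2] := complete_left (family_eqv_tr E1) (family_eqv_tr E').
exists S1, T1; split=> // i; have := family_eqv_tr E2 i.
rewrite trmxK => ->; congr (_ *m _ *m _).
by apply: eq_bigr => j _; rewrite trmxK.
Qed.

(** * The gadget *)

Definition gadget u v M l (C : 'I_u -> 'M[F]_v) (A : 'I_u -> 'M_(M, l))
    (p : 'I_(u + 1)) : 'M_(M + v, l + (v + M)) :=
  match split p with
  | inl i => block_mx (A i) 0 0 (row_mx (C i) 0)
  | inr _ => block_mx 0 (row_mx 0 1%:M) 0 0
  end.

Lemma lincomb_gadget u v M l (C : 'I_u -> 'M_v) (A : 'I_u -> 'M_(M, l)) x (a : 'M_1) :
  lincomb (gadget C A) (row_mx x a) =
  block_mx (lincomb A x) (row_mx 0 (a 0 0)%:M) 0 (row_mx (lincomb C x) 0).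
Proof.
rewrite /lincomb big_split_ord /= big_ord1 row_mxEr /gadget.
rewrite -[rshift u 0]/(unsplit (inr 0)) unsplitK.
rewrite (eq_bigr (fun j => x 0 j *: block_mx (A j) 0 0 (row_mx (C j) 0))); last first.
  move=> j _; rewrite row_mxEl -[lshift 1 j]/(unsplit (inl j)) unsplitK.
  by [].
rewrite -/(lincomb (fun j => block_mx (A j) 0 0 (row_mx (C j) 0)) x).
rewrite lincomb_block lincomb_row_mx !lincomb_cst0.
by rewrite scale_block_mx scale_row_mx !scaler0 add_block_mx !addr0 !add0r scalemx1.
Qed.

(** * Rigidity of the gadget *)

Section Rigidity.
Variables (u v M l : nat) (C : 'I_u -> 'M[F]_v).
Hypothesis C_free : forall x, lincomb C x = 0 -> x = 0.
Hypothesis C_unit : exists x, lincomb C x \in unitmx.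
Hypothesis M_large : (l + v < M)%N.

Let gad (A : 'I_u -> 'M[F]_(M, l)) (x : 'rV_u) (a : F) : 'M_(M + v, l + (v + M)) :=
  block_mx (lincomb A x) (row_mx 0 a%:M) 0 (row_mx (lincomb C x) 0).

(** Dropping the first [l] columns and exchanging the other two column blocks leaves the block
    diagonal of [a%:M] and [lincomb C x]. *)
Lemma rank_gadget_ge A x a : a != 0 -> (M + \rank (lincomb C x) <= \rank (gad A x a))%N.
Proof.
move=> a0; have rka : \rank (a%:M : 'M_M) = M.
  by rewrite mxrank_unit // unitmxE det_scalar unitfE expf_neq0.
rewrite -[X in (X + _)%N]rka -rank_diag_block_mx.
have -> : block_mx a%:M 0 0 (lincomb C x) =
   gad A x a *m col_mx 0 (block_mx 0 1%:M 1%:M 0) :> 'M_(M + v, M + v).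
  by rewrite mul_block_col !mulmx0 !add0r !mul_row_block
     !(mul0mx, mulmx0, mulmx1, add0r, addr0).
exact: mxrankM_maxl.
Qed.

(** Without the last slice only the first [l + v] columns are nonzero. *)
Lemma rank_gadget_le A x : (\rank (gad A x 0) <= l + v)%N.
Proof.
have -> : gad A x 0 = block_mx (lincomb A x) 0 0 (lincomb C x) *m
                      block_mx 1%:M 0 0 (row_mx 1%:M 0).
  rewrite mulmx_block !mul_mx_row !(mul0mx, mulmx0, mulmx1, add0r, addr0).
  by rewrite /gad raddf0 row_mx0.
exact: leq_trans (mxrankM_maxl _ _) (rank_leq_col _).
Qed.

(** The last slice attains the lower bound of [rank_gadget_ge], which singles it out among the
    elements that involve it. *)
Lemma rank_gadget01 A : (\rank (gad A 0 1) <= M)%N.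
Proof.
have -> : gad A 0 1 = col_mx 1%:M 0 *m row_mx 0 (row_mx 0 1%:M).
  rewrite mul_col_row !mul_mx_row !(mul0mx, mulmx0, mulmx1) /gad.
  by rewrite !lincomb0.
exact: leq_trans (mxrankM_maxl _ _) (rank_leq_col _).
Qed.

(** Ranks first make [R] block diagonal; comparing blocks of the matrices then splits [S] and [T].
    Invertibility of [S1] and [T1] is recovered later by [complete_units]. *)
Lemma gadget_rigid (A B : 'I_u -> 'M[F]_(M, l)) R S T :
  R \in unitmx -> S \in unitmx -> T \in unitmx ->
  family_eqv R S T (gadget C A) (gadget C B) ->
  exists (R1 : 'M_u) (S2 T2 : 'M_v) (S1 : 'M_M) (T1 : 'M_l),
  [/\ R1 \in unitmx, S2 \in unitmx, T2 \in unitmx,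
      family_eqv R1 S2 T2 C C & family_eqv R1 S1 T1 A B].
Proof.
move=> uR uS uT E.
have {}E x a : gad B x a = S *m gad A (lsubmx (row_mx x a%:M *m R))
                                 (rsubmx (row_mx x a%:M *m R) 0 0) *m T^T.
  have := family_eqv_lincomb E (row_mx x a%:M).
  rewrite -[row_mx x a%:M *m R in RHS]hsubmxK !lincomb_gadget => <-.
  by rewrite mxE eqxx mulr1n.
have rkE x a : \rank (gad B x a) = \rank (gad A (lsubmx (row_mx x a%:M *m R))
                                 (rsubmx (row_mx x a%:M *m R) 0 0)).
  rewrite E mxrankMfree ?row_free_unit ?unitmx_tr //.
  by rewrite eqmxMfull // row_full_unit.
pose R1 := ulsubmx R; pose c := drsubmx R 0 0.
have mulR x a : row_mx x (a%:M : 'M_1) *m R =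
    row_mx (x *m R1 + a *: dlsubmx R) (x *m ursubmx R + a *: drsubmx R).
  by rewrite -{1}[R]submxK mul_row_block !mul_scalar_mx.
(* The first [u] slices have rank at most [l + v < M], whereas any element involving the last slice
   has rank at least [M]. *)
have R12 : ursubmx R = 0.
  apply/row_matrixP => i; rewrite row0; apply/eqP/negPn/negP => n0.
  have := rkE (delta_mx 0 i) 0.
  rewrite mulR !scale0r !addr0 row_mxKl row_mxKr -!rowE => rk.
  have /rank_gadget_ge : (row i (ursubmx R)) 0 0 != 0.
    apply: contraNneq n0 => z0; apply/eqP/matrixP => p q.
    by rewrite !ord1 z0 mxE.
  move=> /(_ A (row i R1)); rewrite -rk leqNgt.
  by rewrite (leq_ltn_trans (rank_gadget_le _ _)) // ltn_addr.
have := rkE 0 1; rewrite mulR !mul0mx !add0r !scale1r row_mxKl row_mxKr -/c => rk.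
(* Conversely the last slice has rank at least [M], so its counterpart must involve the last
   slice. *)
have c0 : c != 0.
  apply/eqP => c0; move: rk; rewrite c0 => rk.
  have := @rank_gadget_ge B 0 1 (oner_neq0 _).
  by rewrite rk lincomb0 mxrank0 addn0 leqNgt (leq_ltn_trans (rank_gadget_le _ _)).
(* By minimality of the rank, the combination of [C] accompanying the last slice has rank 0;
   freeness of [C] then kills its coefficients. *)
have R21 : dlsubmx R = 0.
  apply: C_free; apply/eqP; rewrite -mxrank_eq0 -leqn0 -(leq_add2l M) addn0.
  by apply: leq_trans (rank_gadget_ge A _ c0) _; rewrite -rk rank_gadget01.
have uR1 : R1 \in unitmx.
  by move: uR; rewrite -[R]submxK R12 R21 block_diag_mx_unit => /andP [].
pose S11 := ulsubmx S; pose S12 := ursubmx S; pose S21 := dlsubmx S; pose S22 := drsubmx S.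
pose Q := T^T; pose Q1 := usubmx Q.
pose Q2 := usubmx (dsubmx Q); pose Q3 := dsubmx (dsubmx Q).
have QE : T^T = col_mx Q1 (col_mx Q2 Q3) by rewrite !vsubmxK.
have SE : S = block_mx S11 S12 S21 S22 by rewrite submxK.
have gadSQ x a : S *m gad A x a *m T^T =
   col_mx (S11 *m lincomb A x *m Q1 + (S12 *m lincomb C x *m Q2 + a *: (S11 *m Q3)))
          (S21 *m lincomb A x *m Q1 + (S22 *m lincomb C x *m Q2 + a *: (S21 *m Q3))).
  rewrite QE SE mulmx_block !mulmx0 !addr0 !mul_mx_row !mulmx0 !add_row_mx !addr0 !add0r.
  by rewrite mul_block_col !mul_row_col !mul_mx_scalar -!scalemxAl.
(* In the equation for the last slice the identity block forces [c *: S11] and the last block of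
   [Q3] to be units, and the zero blocks then give the three vanishing statements. *)
have [S21_0 Q31 Q32] : [/\ S21 = 0, lsubmx Q3 = 0 & lsubmx (rsubmx Q3) = 0].
  have := E 0 1; rewrite mulR !mul0mx !add0r !scale1r row_mxKl row_mxKr R21 -/c.
  rewrite gadSQ /gad !lincomb0 !mulmx0 !mul0mx !add0r row_mx0.
  rewrite -[Q3]hsubmxK -[rsubmx Q3]hsubmxK !mul_mx_row !scale_row_mx.
  rewrite block_mxEv => /eq_col_mx [/eq_row_mx [e1 /eq_row_mx [e2 e3]]].
  move=> /eq_row_mx [_]; rewrite -[X in X = _ -> _](row_mx0 _ _ v M) => /eq_row_mx [_ e4].
  rewrite !scalemxAl in e1 e2 e3.
  have [u1 u2] := mulmx1_unit (esym e3); rewrite !(row_mxKl, row_mxKr); split.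
  - move/esym/eqP: e4; rewrite scaler_eq0 (negPf c0) => /eqP e4.
    by rewrite -[S21](mulmxK u2) e4 mul0mx.
  - by rewrite -[LHS](mulKmx u1) -e1 mulmx0.
  - by rewrite -[LHS](mulKmx u1) -e2 mulmx0.
(* For elements without the last slice, the blocks compared are the upper left one (for [A] and
   [B]), the lower left one (zero) and the lower middle one (for [C]). *)
have U x : [/\ lincomb B x = S11 *m lincomb A (x *m R1) *m lsubmx Q1 +
                             S12 *m lincomb C (x *m R1) *m lsubmx Q2,
     0 = S22 *m lincomb C (x *m R1) *m lsubmx Q2 &
     lincomb C x = S22 *m lincomb C (x *m R1) *m lsubmx (rsubmx Q2)].
  have := E x 0; rewrite mulR !scale0r !addr0 row_mxKl row_mxKr R12 mulmx0 mxE.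
  rewrite gadSQ S21_0 !mul0mx !add0r !scale0r !addr0 /gad block_mxEv.
  rewrite -[in X in _ = X -> _](hsubmxK Q1) -[in X in _ = X -> _](hsubmxK Q2).
  rewrite -[in X in _ = X -> _](hsubmxK (rsubmx Q2)).
  rewrite !mul_mx_row add_row_mx => /eq_col_mx [/eq_row_mx [e1 _]].
  by move=> /eq_row_mx [e2 /eq_row_mx [e3 _]].
have [x ux] := C_unit.
have [_ z0 z1] := U x.
(* At an [x] where [lincomb C x] is a unit, all three factors are units. The zero block then yields
   [Q21], which removes the contribution of [C] to the upper left block. *)
have /andP [/andP [uS2 uCx] uQ] : (S22 \in unitmx) && (lincomb C (x *m R1) \in unitmx)
    && (lsubmx (rsubmx Q2) \in unitmx) by rewrite -!unitmx_mul -z1.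
have Q21 : lsubmx Q2 = 0.
  have uSC : S22 *m lincomb C (x *m R1) \in unitmx by rewrite unitmx_mul uS2.
  by rewrite -[LHS](mulKmx uSC) -z0 mulmx0.
exists R1, S22, (lsubmx (rsubmx Q2))^T, S11, (lsubmx Q1)^T.
split; rewrite ?unitmx_tr // => i.
- by have [_ _] := U (delta_mx 0 i); rewrite lincomb_delta -rowE trmxK.
- have [e _ _] := U (delta_mx 0 i); move: e.
  by rewrite lincomb_delta -rowE trmxK Q21 mulmx0 addr0.
Qed.

End Rigidity.

(** * Extending isomorphisms to the gadget and removing the padding *)

Lemma gadget_extend u v M l (C : 'I_u -> 'M[F]_v) (A B : 'I_u -> 'M_(M, l)) R S2 T2 S1 T1 :
  R \in unitmx -> S2 \in unitmx -> T2 \in unitmx ->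
  S1 \in unitmx -> T1 \in unitmx ->
  family_eqv R S2 T2 C C -> family_eqv R S1 T1 A B ->
  exists R' S T, [/\ R' \in unitmx, S \in unitmx, T \in unitmx
                   & family_eqv R' S T (gadget C A) (gadget C B)].
Proof.
move=> uR uS2 uT2 uS1 uT1 EC EA.
(* The inverse of [S1] on the last columns compensates [S1] on the rows, so the identity block of
   the last slice is fixed. *)
exists (block_mx R 0 0 1%:M), (block_mx S1 0 0 S2),
  (block_mx T1 0 0 (block_mx T2 0 0 (invmx S1)^T)).
split; rewrite ?block_diag_mx_unit ?uR ?uS1 ?uT1 ?uT2 ?unitmx1 //=.
  by rewrite unitmx_tr unitmx_inv.
move=> p; rewrite -(lincomb_row1 (gadget C B)) -[row p 1%:M]hsubmxK.
have -> : row p (block_mx R 0 0 1%:M) =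
   row_mx (lsubmx (row p 1%:M) *m R) (rsubmx (row p (1%:M : 'M_(u + 1)))).
  rewrite -{1}[block_mx _ _ _ _]mul1mx row_mul -{1}[row p 1%:M]hsubmxK.
  by rewrite mul_row_block !mulmx0 addr0 add0r mulmx1.
rewrite !lincomb_gadget.
rewrite (family_eqv_lincomb EC) (family_eqv_lincomb EA).
rewrite !(tr_block_mx, trmx0) trmxK !mulmx_block.
rewrite !(mul0mx, mulmx0, addr0, add0r) !mul_mx_row !mul_row_block.
rewrite !(mul0mx, mulmx0, addr0, add0r).
by rewrite mul_mx_scalar -scalemxAl mulmxV // scalemx1.
Qed.

(** The [k] zero rows provide the height that rigidity requires. Cutting them off again may make the
    row transformation singular, so rigidity is applied to the isomorphism and to its inverse, and
    [complete_units] repairs the result. *)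
Lemma gadget_pad u v m l k (C : 'I_u -> 'M[F]_v) (A B : 'I_u -> 'M_(m, l)) :
  (forall x, lincomb C x = 0 -> x = 0) -> (exists x, lincomb C x \in unitmx) ->
  (l + v < m + k)%N ->
  let pad N i := col_mx (N i) (0 : 'M_(k, l)) in
  (exists R S T, [/\ R \in unitmx, S \in unitmx, T \in unitmx
                   & family_eqv R S T (gadget C (pad A)) (gadget C (pad B))])
  <->
  (exists R S2 T2 S1 T1, [/\ R \in unitmx, S2 \in unitmx /\ T2 \in unitmx,
      S1 \in unitmx /\ T1 \in unitmx,
      family_eqv R S2 T2 C C & family_eqv R S1 T1 A B]).
Proof.
move=> Cf Cu Mb pad.
have unpad N N' R (S : 'M_(m + k)) T : family_eqv R S T (pad N) (pad N') ->
    family_eqv R (ulsubmx S) T N N'.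
  move=> E i; have := E i; rewrite lincomb_col_mx lincomb_cst0.
  rewrite -{1}[S]submxK mul_block_col mul_col_mx !mulmx0 !addr0.
  by move=> /eq_col_mx [].
split=> [[R [S [T [uR uS uT E]]]]|[R [S2 [T2 [S1 [T1 [uR [uS2 uT2] [uS1 uT1] EC EA]]]]]]].
  have [R1 [S2 [T2 [S1 [T1 [uR1 uS2 uT2 EC EA]]]]]] :=
    gadget_rigid Cf Cu Mb uR uS uT E.
  have EV := family_eqvV uR uS uT E.
  have [R1' [_ [_ [S1' [T1' [_ _ _ _ EA']]]]]] : exists (R1 : 'M_u)
      (S2 T2 : 'M_v) S1 T1, [/\ R1 \in unitmx, S2 \in unitmx, T2 \in unitmx,
      family_eqv R1 S2 T2 C C & family_eqv R1 S1 T1 (pad B) (pad A)].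
    by apply: gadget_rigid EV; rewrite ?unitmx_inv.
  have [S3 [T3 [uS3 uT3 E3]]] := complete_units (unpad _ _ _ _ _ EA) (unpad _ _ _ _ _ EA').
  by exists R1, S2, T2, S3, T3.
apply: (@gadget_extend _ _ _ _ C _ _ R S2 T2 (block_mx S1 0 0 1%:M) T1) => //.
  by rewrite block_diag_mx_unit uS1 unitmx1.
move=> i; rewrite lincomb_col_mx lincomb_cst0 mul_block_col !mulmx0 mul0mx !addr0.
by rewrite mul_col_mx mul0mx -EA.
Qed.

End MatrixFamilies.

(** * Rigid tensors *)

Section Rigidifiers.
Local Open Scope ring_scope.
Variable F : fieldType.

(* The unit tensor for [u = v], and for [u = v.+1] the unit tensor together with
   a nilpotent shift, which orders the coordinates along a directed path. *)
Definition rigidifier u v (p : 'I_u) : 'M[F]_v :=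
  \matrix_(a, b) (if (p < v)%N then (a == p :> nat) && (b == p :> nat)
                  else (b == a.+1 :> nat))%:R.

Lemma unit_row_neq0 n (R : 'M[F]_n) i : R \in unitmx -> exists j, R i j != 0.
Proof.
move=> uR; apply/existsP; apply: contraTT uR => /existsPn R0.
rewrite -row_free_unit; apply/row_freePn.
by exists i; rewrite (_ : row i R = 0) ?sub0mx //; apply/rowP => j;
   rewrite !mxE; apply/eqP; have := R0 j; rewrite negbK.
Qed.

Lemma unit_rows_inj n (R : 'M[F]_n) i i' j : R \in unitmx ->
  (forall k, k != j -> R i k = 0) -> (forall k, k != j -> R i' k = 0) -> i = i'.
Proof.
move=> uR Ri Ri'; apply/eqP/negPn/negP => ii'.
(* Both rows are multiples of the same basis vector, so this combination is killed by [R];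
   invertibility makes its coefficients vanish, and then row [i'] is zero. *)
pose y : 'rV_n := R i' j *: delta_mx 0 i - R i j *: delta_mx 0 i'.
have y0 : y = 0.
  rewrite -[y](mulmxK uR) mulmxBl -!scalemxAl -!rowE.
  rewrite (_ : _ - _ = 0) ?mul0mx //; apply/rowP => k; rewrite !mxE.
  have [->|kj] := eqVneq k j; first by rewrite mulrC subrr.
  by rewrite (Ri k) // (Ri' k) // !mulr0 subrr.
have [k] := unit_row_neq0 i' uR.
have [->|kj] := eqVneq k j; last by rewrite Ri' // eqxx.
move/rowP/(_ i): y0; rewrite !mxE !eqxx (negPf ii') mulr1 mulr0 subr0 => ->.
by rewrite eqxx.
Qed.

(** Rows and columns of a unit are nonzero, so having at most one nonzero entry already means having
    exactly one. *)
Lemma MonP n (R : 'M[F]_n) :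
  reflect [/\ R \in unitmx,
     forall i j j', R i j != 0 -> R i j' != 0 -> j = j' &
     forall i i' j, R i j != 0 -> R i' j != 0 -> i = i'] (Mon F n R).
Proof.
apply: (iffP and3P) => [[uR /forallP rR /forallP cR]|[uR rR cR]]; split=> //.
- move=> i j j' Rj Rj'; have /cards1P [k E] := rR i.
  have : j \in [set j | R i j != 0] by rewrite inE.
  have : j' \in [set j | R i j != 0] by rewrite inE.
  by rewrite E !inE => /eqP -> /eqP ->.
- move=> i i' j Ri Ri'; have /cards1P [k E] := cR j.
  have : i \in [set i | R i j != 0] by rewrite inE.
  have : i' \in [set i | R i j != 0] by rewrite inE.
  by rewrite E !inE => /eqP -> /eqP ->.
- apply/forallP => i; apply/cards1P; have [j Rj] := unit_row_neq0 i uR.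
  exists j; apply/setP => k; rewrite !inE; apply/idP/eqP => [Rk|->//].
  exact: rR Rk Rj.
- have uR' : R^T \in unitmx by rewrite unitmx_tr.
  apply/forallP => j; apply/cards1P; have [i Ri] := unit_row_neq0 j uR'.
  rewrite mxE in Ri; exists i; apply/setP => k; rewrite !inE.
  by apply/idP/eqP => [Rk|->//]; apply: cR Rk Ri.
Qed.

(** * Span and automorphisms of the rigidifiers *)

Lemma lincomb_rigidifier_unit n (x : 'rV_n) :
  lincomb (@rigidifier n n) x = diag_mx x.
Proof.
apply/matrixP => a b; rewrite summxE (bigD1 a) //= big1 => [|p pa].
  by rewrite !mxE ltn_ord eqxx addr0 mulr_natr /= eq_sym.
by rewrite !mxE ltn_ord eq_sym val_eqE (negPf pa) mulr0.
Qed.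

Lemma lincomb_rigidifier_path v (x : 'rV_v.+1) a b :
  lincomb (@rigidifier v.+1 v) x a b =
  if a == b then x 0 (widen_ord (leqnSn v) a)
  else if b == a.+1 :> nat then x 0 ord_max else 0.
Proof.
rewrite summxE big_ord_recr /= !mxE ltnn.
under eq_bigr => p _ do rewrite !mxE /= ltn_ord.
rewrite (bigD1 a) //= big1 => [|p pa]; last first.
  by rewrite -val_eqE /= in pa; rewrite eq_sym (negPf pa) mulr0.
rewrite eqxx addr0 /= eq_sym -val_eqE /=.
case: (eqVneq (a : nat) b) => [->|ab].
  by rewrite (ltn_eqF (ltnSn b)) mulr0 addr0 mulr1.
by rewrite mulr0 add0r; case: eqP => _; rewrite ?mulr1 ?mulr0.
Qed.

(** Slice [i] is a diagonal matrix unit. Pulled back through [S] and [T] it is the outer product of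
    a column of [invmx S] and one of [invmx T]. *)
Lemma rigidifier_auto_rank1 u v (R : 'M[F]_u) S T (i : 'I_u) : (i < v)%N ->
  S \in unitmx -> T \in unitmx ->
  family_eqv R S T (@rigidifier u v) (@rigidifier u v) ->
  exists p q : 'I_v -> F,
    forall a b, lincomb (@rigidifier u v) (row i R) a b = p a * q b.
Proof.
move=> iv uS uT /(_ i) E; pose i' := Ordinal iv.
exists (fun a => invmx S a i'), (fun b => invmx T b i') => a b.
have -> : lincomb (@rigidifier u v) (row i R) =
          invmx S *m rigidifier v i *m (invmx T)^T.
  rewrite E !mulmxA mulVmx // mul1mx -mulmxA -trmx_mul mulVmx //.
  by rewrite trmx1 mulmx1.
rewrite mxE (bigD1 i') //= big1 ?addr0 => [|k ki]; last first.
  rewrite mxE big1 ?mul0r // => k' _; rewrite !mxE iv -(val_eqE k i') /= in ki *.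
  by rewrite (negPf ki) andbF mulr0.
rewrite mxE (bigD1 i') //= big1 ?addr0 => [|k ki]; last first.
  by rewrite mxE iv; rewrite -val_eqE /= in ki; rewrite (negPf ki) mulr0.
by rewrite !mxE iv /= eqxx mulr1.
Qed.

(** A diagonal matrix that is an outer product has at most one nonzero entry: two of them would give
    a nonzero entry off the diagonal. *)
Lemma rigidifier_auto_Mon n (R : 'M[F]_n) S T :
  R \in unitmx -> S \in unitmx -> T \in unitmx ->
  family_eqv R S T (@rigidifier n n) (@rigidifier n n) -> Mon F n R.
Proof.
move=> uR uS uT E.
have rR i j j' : R i j != 0 -> R i j' != 0 -> j = j'.
  have [p [q pq]] := rigidifier_auto_rank1 (ltn_ord i) uS uT E.
  rewrite lincomb_rigidifier_unit in pq.
  have := pq j j; have := pq j' j'; have := pq j j'; rewrite !mxE !eqxx !mulr1n.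
  have [//|_ z e e'] := eqVneq j j'; rewrite e e' !mulf_eq0 !negb_or.
  move=> /andP [p0 _] /andP [_ q0]; move/esym/eqP: z.
  by rewrite mulf_eq0 (negPf p0) (negPf q0).
apply/MonP; split=> // i i' j Ri Ri'; apply: (unit_rows_inj (j := j) uR) => k kj.
  by apply/eqP; apply: contraNT kj => Rk; apply/eqP/(rR i).
by apply/eqP; apply: contraNT kj => Rk; apply/eqP/(rR i').
Qed.

Lemma Mon_rigidifier_auto n (R : 'M[F]_n) : Mon F n R ->
  exists S T, [/\ S \in unitmx, T \in unitmx
     & family_eqv R S T (@rigidifier n n) (@rigidifier n n)].
Proof.
move=> /MonP [uR rR cR].
(* [S] carries the permutation underlying [R], and [T] the same permutation with inverse scalars,
   which cancel those of [R]. As 0 is its own inverse, [T] has the support of [R]. *)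
pose S : 'M[F]_n := \matrix_(i, j) (R i j != 0)%:R.
pose T : 'M[F]_n := \matrix_(i, j) (R i j)^-1.
have ST a b j : a != b -> R a j != 0 -> R b j = 0.
  by move=> ab Ra; apply/eqP; apply: contraNT ab => Rb; rewrite (cR a b j).
have rR0 a k j : R a j != 0 -> k != j -> R a k = 0.
  by move=> Ra kj; apply/eqP; apply: contraNT kj => Rk; rewrite (rR a k j).
exists S, T; split.
- have /mulmx1_unit [] // : S *m S^T = 1%:M.
  apply/matrixP => a b; rewrite !mxE; have [->|ab] := eqVneq a b.
    have [j Rj] := unit_row_neq0 b uR.
    rewrite (bigD1 j) //= big1 => [|k kj]; first by rewrite !mxE Rj mulr1 addr0.
    by rewrite !mxE (rR0 b k j) // eqxx mul0r.
  rewrite big1 // => j _; rewrite !mxE; case: (eqVneq (R a j) 0) => [_|Ra] /=; rewrite ?mul0r //.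
  by rewrite (ST a b) // eqxx mulr0.
- have /mulmx1_unit [] // : T *m R^T = 1%:M.
  apply/matrixP => a b; rewrite !mxE; have [->|ab] := eqVneq a b.
    have [j Rj] := unit_row_neq0 b uR.
    rewrite (bigD1 j) //= big1 => [|k kj]; first by rewrite !mxE mulVf ?addr0.
    by rewrite !mxE (rR0 b k j) // mulr0.
  rewrite big1 // => j _; rewrite !mxE; case: (eqVneq (R a j) 0) => [->|Ra].
    by rewrite invr0 mul0r.
  by rewrite (ST a b) // mulr0.
- move=> i; rewrite lincomb_rigidifier_unit mul_mx_diag; apply/matrixP => a b.
  rewrite !mxE ltn_ord !val_eqE.
  under eq_bigr => j _ do rewrite !mxE.
  have [->|ai] := eqVneq a i => /=; last first.
    rewrite big1 // => j _; case: (eqVneq (R i j) 0) => [->|Ri]; first by rewrite mulr0 mul0r.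
    by rewrite (ST i a) // 1?eq_sym // eqxx !mul0r.
  have [->|bi] := eqVneq b i => /=; last first.
    rewrite big1 // => j _; case: (eqVneq (R i j) 0) => [->|Ri]; first by rewrite mulr0 mul0r.
    by rewrite (ST i b) // 1?eq_sym // invr0 mulr0.
  have [j Rj] := unit_row_neq0 i uR.
  rewrite (bigD1 j) //= Rj mul1r divff // big1 ?addr0 // => k kj.
  by rewrite (rR0 i k j) // mulr0 mul0r.
Qed.

Lemma rigidifier_unit_free n (x : 'rV[F]_n) : lincomb (@rigidifier n n) x = 0 -> x = 0.
Proof.
rewrite lincomb_rigidifier_unit => /matrixP E; apply/rowP => i.
by have := E i i; rewrite !mxE eqxx.
Qed.

Lemma rigidifier_unit_unit n : exists x : 'rV[F]_n, lincomb (@rigidifier n n) x \in unitmx.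
Proof.
exists (const_mx 1); rewrite lincomb_rigidifier_unit.
by rewrite diag_const_mx unitmx1.
Qed.

Lemma rigidifier_path_free v (x : 'rV[F]_v.+1) : (1 < v)%N ->
  lincomb (@rigidifier v.+1 v) x = 0 -> x = 0.
Proof.
move=> v1 /matrixP E; apply/rowP => i; rewrite mxE.
have [iv|iv] := ltnP i v.
  have := E (Ordinal iv) (Ordinal iv); rewrite lincomb_rigidifier_path eqxx mxE.
  by move=> <-; congr (x 0 _); apply: val_inj.
(* The entry (0, 1) reads off the coefficient of the shift; it exists because [1 < v]. *)
have := E (Ordinal (ltnW v1)) (Ordinal v1); rewrite lincomb_rigidifier_path mxE /= => <-.
by congr (x 0 _); apply: val_inj => /=; apply/eqP; rewrite eqn_leq iv -ltnS ltn_ord.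
Qed.

Lemma rigidifier_path_unit v : exists x : 'rV[F]_v.+1, lincomb (@rigidifier v.+1 v) x \in unitmx.
Proof.
exists (\row_i (i < v)%N%:R); rewrite (_ : lincomb _ _ = 1%:M) ?unitmx1 //.
apply/matrixP => a b; rewrite lincomb_rigidifier_path !mxE /= ltnn ltn_ord.
by case: eqP => // _; case: ifP.
Qed.

(* The rank-one slices can only be permuted among themselves; as the slice of
   the shift is preserved up to the diagonal, the permutation maps the directed
   path to itself. *)
Lemma rigidifier_auto_diag v (R : 'M[F]_v.+1) S T : (2 < v)%N ->
  R \in unitmx -> S \in unitmx -> T \in unitmx ->
  family_eqv R S T (@rigidifier v.+1 v) (@rigidifier v.+1 v) ->
  forall i j : 'I_v.+1, (i < v)%N -> (R i j != 0) = (i == j).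
Proof.
move=> v2 uR uS uT E.
pose w := widen_ord (leqnSn v).
have w_inj : injective w by move=> a b /(congr1 val) /= ab; apply: val_inj.
(* The shift coefficient stands at (0, 1) and (1, 2), while (0, 2) is zero. In an outer product the
   zero forces one of the other two to vanish; three coordinates are needed, hence [2 < v]. *)
have Rmax i : R (w i) ord_max = 0.
  have [p [q pq]] := @rigidifier_auto_rank1 _ v _ _ _ (w i) (ltn_ord i) uS uT E.
  pose o0 := Ordinal (ltnW (ltnW v2)); pose o1 := Ordinal (ltnW v2); pose o2 := Ordinal v2.
  have := pq o0 o1; have := pq o1 o2; have := pq o0 o2.
  rewrite !lincomb_rigidifier_path /= !mxE => /esym/eqP z e1 e2.
  apply/eqP; move: z; rewrite mulf_eq0 => /orP [] /eqP z.
    by rewrite e2 z mul0r.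
  by rewrite e1 z mulr0.
have rR i j j' : R (w i) (w j) != 0 -> R (w i) (w j') != 0 -> j = j'.
  have [p [q pq]] := @rigidifier_auto_rank1 _ v _ _ _ (w i) (ltn_ord i) uS uT E.
  have := pq j j; have := pq j' j'; have := pq j j'.
  rewrite !lincomb_rigidifier_path !eqxx !mxE Rmax.
  have [//|_ z e e'] := eqVneq j j'; rewrite e e' !mulf_eq0 !negb_or.
  move=> /andP [p0 _] /andP [_ q0]; move/esym/eqP: z; rewrite if_same.
  by rewrite mulf_eq0 (negPf p0) (negPf q0).
have wP (j : 'I_v.+1) : j != ord_max -> exists j', j = w j'.
  move=> jm; have jv : (j < v)%N.
    by rewrite ltn_neqAle -ltnS ltn_ord andbT.
  by exists (Ordinal jv); apply: val_inj.
have [sg sgP] : exists sg : {ffun 'I_v -> 'I_v}, forall i, R (w i) (w (sg i)) != 0.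
  have ex i : exists j, R (w i) (w j) != 0.
    have [j] := unit_row_neq0 (w i) uR.
    have [->|/wP [j' ->]] := eqVneq j ord_max; first by rewrite Rmax eqxx.
    by exists j'.
  by exists [ffun i => xchoose (ex i)] => i; rewrite ffunE; apply: (xchooseP (ex i)).
have sgE i k : k != w (sg i) -> R (w i) k = 0.
  move=> ki; apply/eqP; apply: contraNT ki => Rk.
  have /wP [k' Ek] : k != ord_max by apply: contraNneq Rk => ->; rewrite Rmax.
  by rewrite Ek in Rk *; rewrite (rR _ _ _ Rk (sgP i)).
have sg_inj : injective sg.
  move=> i i' ii'; apply: w_inj; apply: (unit_rows_inj (j := w (sg i)) uR) => k.
    exact: sgE.
  by rewrite ii'; apply: sgE.
have Xi i : lincomb (@rigidifier v.+1 v) (row (w i) R) =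
            R (w i) (w (sg i)) *: delta_mx (sg i) (sg i).
  apply/matrixP => a b; rewrite lincomb_rigidifier_path !mxE Rmax if_same.
  have [->|ai] := eqVneq a (sg i).
    by have [->|bi] := eqVneq (sg i) b; rewrite ?eqxx ?mulr1 // ?mulr0.
  have [<-|_] := eqVneq a b; rewrite ?andFb ?mulr0 //.
  by rewrite sgE // inj_eq.
(* Comparing the rank-one slices shows that column [sg i] of [S] and of [T] is supported at [i]
   only. *)
have Ei i a b : ((a == i) && (b == i))%:R =
    R (w i) (w (sg i)) * (S a (sg i) * T b (sg i)).
  have /matrixP/(_ a b) := E (w i); rewrite Xi mxE /= ltn_ord !val_eqE => ->.
  rewrite -scalemxAr -scalemxAl mxE; congr (_ * _).
  rewrite mxE (bigD1 (sg i)) //= big1 ?addr0 => [|k ki]; last first.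
    by rewrite mxE big1 ?mul0r // => k' _; rewrite mxE (negPf ki) andbF mulr0.
  rewrite [_^T _ _]mxE mxE (bigD1 (sg i)) //= big1 ?addr0 => [|k ki].
    by rewrite mxE !eqxx mulr1.
  by rewrite mxE (negPf ki) mulr0.
have S0 i a : a != i -> S a (sg i) = 0.
  move=> ai; have := Ei i i i; rewrite eqxx => /eqP.
  have := Ei i a i; rewrite (negPf ai) /= => /esym/eqP.
  rewrite !mulf_eq0 (negPf (sgP i)) /= => /orP [/eqP //|/eqP ->].
  by rewrite !mulr0 oner_eq0.
have T0 i a : a != i -> T a (sg i) = 0.
  move=> ai; have := Ei i i i; rewrite eqxx => /eqP.
  have := Ei i i a; rewrite (negPf ai) andbF /= => /esym/eqP.
  rewrite !mulf_eq0 (negPf (sgP i)) /= => /orP [/eqP ->|/eqP //].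
  by rewrite mul0r mulr0 oner_eq0.
have onto k : exists i, k = sg i.
  by have [g _ gK] := injF_bij sg_inj; exists (g k).
(* The shift is nonzero at consecutive [a], [b], so the combination it comes from is nonzero at
   [sg a], [sg b]. That matrix is bidiagonal and [sg] is injective, so these are consecutive too. *)
have Emax (a b : 'I_v) : (b == a.+1 :> nat) -> sg b = (sg a).+1 :> nat.
  move=> ab; have /matrixP/(_ a b) := E ord_max.
  rewrite mxE /= ltnn ab => /esym.
  rewrite mxE (bigD1 (sg b)) //= big1 ?addr0 => [|k]; last first.
    by have [i ->] := onto k => ki; rewrite [_^T _ _]mxE T0 ?mulr0 // eq_sym -(inj_eq sg_inj).
  rewrite mxE (bigD1 (sg a)) //= big1 ?addr0 => [|k]; last first.
    by have [i ->] := onto k => ki; rewrite S0 ?mul0r // eq_sym -(inj_eq sg_inj).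
  rewrite lincomb_rigidifier_path (inj_eq sg_inj) -val_eqE /= (eqP ab) (ltn_eqF (ltnSn a)).
  by case: eqP => // _; rewrite mulr0 mul0r => /esym/eqP; rewrite oner_eq0.
have v0 : (0 < v)%N by apply: ltn_trans v2.
have sgD k (kv : (k < v)%N) : sg (Ordinal kv) = (sg (Ordinal v0) + k)%N :> nat.
  elim: k kv => [|k IH] kv; first by rewrite addn0; congr (val (sg _)); apply: val_inj.
  by rewrite (Emax (Ordinal (ltnW kv))) // IH addnS.
(* [sg] is a translation, and its value at [v.-1] is still below [v]. *)
have sg0 : sg (Ordinal v0) = 0%N :> nat.
  have lv : (v.-1 < v)%N by rewrite prednK.
  have := ltn_ord (sg (Ordinal lv)); rewrite sgD.
  by rewrite -[X in (_ < X)%N](prednK v0) ltnS -[X in (_ <= X)%N]add0n leq_add2r leqn0 => /eqP.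
have sgid i : sg i = i.
  by apply: val_inj; case: i => i iv; rewrite [LHS]sgD sg0.
move=> i j iv; have -> : i = w (Ordinal iv) by apply: val_inj.
have [<-|ij] := eqVneq (w (Ordinal iv)) j; first by rewrite -{2}[Ordinal iv]sgid sgP.
by rewrite sgE ?eqxx // sgid eq_sym.
Qed.

Lemma diag_rigidifier_auto v (d : 'rV[F]_v.+1) : (forall i, d 0 i != 0) -> d 0 ord_max = 1 ->
  exists S T, [/\ S \in unitmx, T \in unitmx
     & family_eqv (diag_mx d) S T (@rigidifier v.+1 v) (@rigidifier v.+1 v)].
Proof.
(* Prefix products make the ratio of neighbouring [t] equal to an entry of [d], which handles the
   diagonal slices. On the superdiagonal the two factors cancel, so the shift is fixed because its
   own scalar is 1. *)
move=> d0 dmax; pose t i := \prod_(j < i) d 0 (inord j).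
have t0 i : t i != 0 by apply/prodf_neq0 => j _; apply: d0.
exists (diag_mx (\row_i (t i.+1)^-1)), (diag_mx (\row_i t i)).
have udiag (x : 'rV[F]_v) : (forall i, x 0 i != 0) -> diag_mx x \in unitmx.
  by move=> x0; rewrite unitmxE det_diag unitfE; apply/prodf_neq0 => i _.
split; first by apply: udiag => i; rewrite mxE invr_neq0.
  by apply: udiag => i; rewrite mxE.
move=> p; rewrite tr_diag_mx row_diag_mx /lincomb (bigD1 p) //= big1 ?addr0; last first.
  by move=> q qp; rewrite !mxE (negPf qp) andbF mulr0 scale0r.
rewrite mul_mx_diag mul_diag_mx; apply/matrixP => a b; rewrite !mxE !eqxx mulr1.
have [pv|vp] := ltnP p v.
  have [->|] := eqVneq (a : nat) p; last by rewrite !mulr0 mul0r.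
  have [->|] := eqVneq (b : nat) p; last by rewrite !mulr0 mul0r.
  have tS : t p.+1 = d 0 p * t p by rewrite /t big_ord_recr /= inord_val mulrC.
  by rewrite mulr1 -mulrA -tS mulVf.
have -> : p = ord_max by apply: val_inj; apply/eqP; rewrite eqn_leq vp -ltnS ltn_ord.
have [->|] := eqVneq (b : nat) a.+1; last by rewrite !mulr0 mul0r.
by rewrite dmax !mulr1 mulVf.
Qed.

End Rigidifiers.

(** * The reduction *)

Section Reduction.
Local Open Scope ring_scope.
Variable F : fieldType.

Definition slices n m l (A : tensor F n m l) (i : 'I_n) : 'M_(m, l) :=
  \matrix_(j, k) A (i, j, k).

(** Zero slices match the number of slices to that of the rigidifier, which exceeds [n] in the
    diagonal case. *)
Definition extend_family u n m l (N : 'I_n -> 'M[F]_(m, l)) (p : 'I_u) : 'M_(m, l) :=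
  if insub (p : nat) is Some i then N i else 0.

(** The [(l + v).+1] zero rows make the height exceed [l + v], as rigidity demands, for every
    [m]. *)
Definition reduction u v n m l (A : tensor F n m l) :
    tensor F (u + 1) (m + (l + v).+1 + v) (l + (v + (m + (l + v).+1))) :=
  [ffun x => gadget (@rigidifier F u v)
     (fun p => col_mx (extend_family (slices A) p) 0) x.1.1 x.1.2 x.2].

Lemma extend_family_id n m l (N : 'I_n -> 'M[F]_(m, l)) p : extend_family N p = N p.
Proof. by rewrite /extend_family valK. Qed.

Lemma extend_family_lt u n m l (N : 'I_n -> 'M[F]_(m, l)) (p : 'I_u) (i : 'I_n) :
  p = i :> nat -> extend_family N p = N i.
Proof. by rewrite /extend_family => ->; rewrite valK. Qed.

Lemma extend_family_ge u n m l (N : 'I_n -> 'M[F]_(m, l)) (p : 'I_u) :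
  (n <= p)%N -> extend_family N p = 0.
Proof. by move=> np; rewrite /extend_family insubF // ltnNge np. Qed.

Lemma lincomb_extend u n m l (nu : (n <= u)%N) (N : 'I_n -> 'M[F]_(m, l)) x :
  lincomb (extend_family N) x = lincomb N (\row_j x 0 (widen_ord nu j)).
Proof.
rewrite /lincomb (bigID (fun p : 'I_u => p < n)%N) /= addrC big1 ?add0r; last first.
  by move=> p np; rewrite extend_family_ge ?scaler0 // leqNgt.
rewrite (big_ord_narrow nu) /=; apply: eq_bigr => j _; rewrite mxE.
by rewrite (@extend_family_lt _ _ _ _ _ _ j).
Qed.

Lemma reduction_iso u v n m l (A B : tensor F n m l) :
  (forall x, lincomb (@rigidifier F u v) x = 0 -> x = 0) ->
  (exists x, lincomb (@rigidifier F u v) x \in unitmx) ->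
  tensor_isomorphic (GL F _) (GL F _) (GL F _) (reduction u v A) (reduction u v B)
  <->
  (exists R S2 T2 S1 T1, [/\ R \in unitmx, S2 \in unitmx /\ T2 \in unitmx,
      S1 \in unitmx /\ T1 \in unitmx,
      family_eqv R S2 T2 (@rigidifier F u v) (@rigidifier F u v) &
      family_eqv R S1 T1 (extend_family (slices A)) (extend_family (slices B))]).
Proof.
move=> Cf Cu; have lt_k : (l + v < m + (l + v).+1)%N by rewrite addnS ltnS leq_addl.
apply: iff_trans (gadget_pad _ _ Cf Cu lt_k).
have slE D i : \matrix_(j, k) reduction u v D (i, j, k) =
    gadget (@rigidifier F u v) (fun p => col_mx (extend_family (slices D) p) 0) i.
  by apply/matrixP => j k; rewrite mxE ffunE.
split=> [[R [S [T [uR uS uT /tensor_act_slices E]]]]|[R [S [T [uR uS uT E]]]]].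
  exists R, S, T; split=> // i; rewrite -slE E; congr (_ *m _ *m _).
  by apply: eq_bigr => j _; rewrite slE.
exists R, S, T; split=> //; apply/tensor_act_slices => i; rewrite slE E.
by congr (_ *m _ *m _); apply: eq_bigr => j _; rewrite slE.
Qed.

Lemma reduction_Mon n m l (A B : tensor F n m l) :
  tensor_isomorphic (Mon F n) (GL F m) (GL F l) A B <->
  tensor_isomorphic (GL F _) (GL F _) (GL F _) (reduction n n A) (reduction n n B).
Proof.
apply: iff_trans (iff_sym (reduction_iso _ _ (@rigidifier_unit_free _ _)
  (@rigidifier_unit_unit _ _))).
split=> [[R [S [T [MR uS uT /tensor_act_slices E]]]]|].
  have [S2 [T2 [uS2 uT2 EC]]] := Mon_rigidifier_auto MR.
  have /and3P [uR _ _] := MR.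
  exists R, S2, T2, S, T; split=> // i; rewrite extend_family_id [LHS]E.
  by congr (_ *m _ *m _); apply: eq_bigr => j _; rewrite extend_family_id.
move=> [R [S2 [T2 [S [T [uR [uS2 uT2] [uS uT] EC E]]]]]].
exists R, S, T; split=> //; first exact: rigidifier_auto_Mon EC.
apply/tensor_act_slices => i; have := E i; rewrite extend_family_id => e; rewrite [LHS]e.
by congr (_ *m _ *m _); apply: eq_bigr => j _; rewrite extend_family_id.
Qed.

Lemma diag_mx_unit n (d : 'rV[F]_n) : (diag_mx d \in unitmx) = [forall i, d 0 i != 0].
Proof.
rewrite unitmxE det_diag unitfE.
by apply/prodf_neq0/forallP => [d0 i|d0 i _]; apply: d0.
Qed.

Lemma lincomb_row_diag u a b (N : 'I_u -> 'M[F]_(a, b)) (d : 'rV_u) i :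
  lincomb N (row i (diag_mx d)) = d 0 i *: N i.
Proof.
rewrite /lincomb (bigD1 i) //= !mxE eqxx mulr1n big1 ?addr0 // => j ji.
by rewrite !mxE eq_sym (negPf ji) scale0r.
Qed.

(** The path has [n.+3] vertices so that it has more than two even for [n = 0]; the shift is one
    further slice. *)
Lemma reduction_Diag n m l (A B : tensor F n m l) :
  tensor_isomorphic (Diag F n) (GL F m) (GL F l) A B <->
  tensor_isomorphic (GL F _) (GL F _) (GL F _)
    (reduction n.+4 n.+3 A) (reduction n.+4 n.+3 B).
Proof.
have nu : (n <= n.+4)%N by rewrite -addn4 leq_addr.
apply: iff_trans (iff_sym (reduction_iso _ _
  (fun x => @rigidifier_path_free _ n.+3 x isT) (@rigidifier_path_unit _ _))).
split=> [[R [S [T [/andP [uR /is_diag_mxP dR] uS uT /tensor_act_slices E]]]]|].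
  have RE : R = diag_mx (\row_i R i i).
    apply/matrixP => i j; rewrite !mxE; have [->//|ij] := eqVneq i j.
    by rewrite dR.
  (* Padding with 1 keeps [d] invertible and gives the shift the scalar 1. *)
  pose d : 'rV[F]_n.+4 := \row_p (if insub (p : nat) is Some i then R i i else 1).
  have d0 p : d 0 p != 0.
    rewrite mxE; case: insubP => [i _ _|_]; last exact: oner_neq0.
    have : diag_mx (\row_i R i i) \in unitmx by rewrite -RE.
    by rewrite diag_mx_unit => /forallP /(_ i); rewrite mxE.
  have dmax : d 0 ord_max = 1.
    by rewrite mxE insubF //= ltnNge -addn3 leq_addr.
  have [S2 [T2 [uS2 uT2 EC]]] := diag_rigidifier_auto d0 dmax.
  exists (diag_mx d), S2, T2, S, T; split=> //.
    by rewrite diag_mx_unit; apply/forallP.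
  move=> p; rewrite lincomb_row_diag; have [pn|np] := ltnP p n; last first.
    by rewrite !extend_family_ge // scaler0 mulmx0 mul0mx.
  rewrite !(@extend_family_lt _ _ _ _ _ p (Ordinal pn)) // [LHS]E {1}RE lincomb_row_diag.
  by rewrite !mxE insubT /=.
move=> [R [S2 [T2 [S [T [uR [uS2 uT2] [uS uT] EC E]]]]]].
have dR := @rigidifier_auto_diag _ n.+3 _ _ _ isT uR uS2 uT2 EC.
pose w := widen_ord nu.
(* The first [n] rows of [R] are diagonal, and slices beyond [n] are zero, so the leading block
   alone carries one family to the other. *)
pose R1 := diag_mx (\row_i R (w i) (w i)).
have wlt i : (w i < n.+3)%N by rewrite (leq_trans (ltn_ord i)) // -addn3 leq_addr.
exists R1, S, T; split=> //.
  rewrite /Diag diag_mx_is_diag andbT diag_mx_unit; apply/forallP => i.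
  by rewrite mxE dR ?eqxx.
apply/tensor_act_slices => i; have := E (w i).
rewrite (@extend_family_lt _ _ _ _ _ _ i) // => E1; rewrite [LHS]E1.
congr (_ *m _ *m _); rewrite (lincomb_extend nu); congr (lincomb _ _).
apply/rowP => j; rewrite !mxE; have [->|ij] := eqVneq i j; first by rewrite mulr1n.
by apply/eqP; rewrite -[_ == _]negbK dR // -val_eqE.
Qed.

End Reduction.

(** * Running time of programs *)

Section Cost.
Variables (F : fieldType) (sz : F -> nat).
Implicit Type s : state F.

Fixpoint nsize (e : nexp) : nat :=
  match e with
  | NConst _ | NReg _ => 1
  | NAdd e1 e2 | NSub e1 e2 | NMul e1 e2 | NDiv e1 e2 | NMod e1 e2 =>
      (nsize e1 + nsize e2).+1
  end.

Fixpoint nmax (e : nexp) : nat :=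
  match e with
  | NConst v => v
  | NReg _ => 0
  | NAdd e1 e2 | NSub e1 e2 | NMul e1 e2 | NDiv e1 e2 | NMod e1 e2 =>
      maxn (nmax e1) (nmax e2)
  end.

(** The largest index expression of the program, the row-major address of an input entry, has nine
    nodes; constants are at most 4. *)
Definition nsmall (e : nexp) : bool := (nsize e <= 9) && (nmax e <= 4).

Fixpoint bsize (b : bexp F) : nat :=
  match b with
  | BLeq _ _ | BEqF _ _ => 1
  | BNot b1 => (bsize b1).+1
  | BAnd b1 b2 => (bsize b1 + bsize b2).+1
  end.

Fixpoint bsmall (b : bexp F) : bool :=
  match b with
  | BLeq e1 e2 => nsmall e1 && nsmall e2
  | BEqF _ _ => false
  | BNot b1 => bsmall b1
  | BAnd b1 b2 => bsmall b1 && bsmall b2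
  end.

Variables (B Z : nat).
Hypothesis B_ge4 : 4 <= B.

Definition regs_le s : Prop := forall x, nreg s x <= B.

(** A product adds exponents, and the extra factor [B] contributed by each inner node absorbs a sum
    of two powers. *)
Lemma neval_le s e : regs_le s -> nmax e <= 4 -> neval s e <= B ^ nsize e.
Proof.
move=> rs; have B0 : 0 < B by apply: leq_trans B_ge4.
have up a b : B ^ a <= B ^ (a + b).+1.
  by rewrite leq_pexp2l // -addnS leq_addr.
elim: e => [v|x|e1 IH1 e2 IH2|e1 IH1 e2 IH2|e1 IH1 e2 IH2|e1 IH1 e2 IH2|e1 IH1 e2 IH2] /=.
- by move=> v4; rewrite expn1 (leq_trans v4).
- by rewrite expn1.
all: rewrite geq_max => /andP [/IH1 {}IH1 /IH2 {}IH2].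
- have h1 : B ^ nsize e1 <= B ^ (nsize e1 + nsize e2) by rewrite leq_pexp2l // leq_addr.
  have h2 : B ^ nsize e2 <= B ^ (nsize e1 + nsize e2) by rewrite leq_pexp2l // leq_addl.
  by rewrite expnS; nia.
- by apply: leq_trans (leq_subr _ _) (leq_trans IH1 (up _ _)).
- by rewrite -addnS expnD leq_mul // (leq_trans IH2) // leq_pexp2l.
- by apply: leq_trans (leq_div _ _) (leq_trans IH1 (up _ _)).
- by apply: leq_trans (leq_mod _ _) (leq_trans IH1 (up _ _)).
Qed.

(** This crude linear bound suffices because all values met are polynomial in the input size. *)
Lemma nat_len_le v : nat_len v <= v.+1.
Proof.
rewrite /nat_len ltnS; case: v => [|v]; first by rewrite trunc_log0.
by apply: leq_trans (trunc_logP (ltnSn 1) (ltn0Sn v)); rewrite ltnW // ltn_expl.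
Qed.

Lemma ncost_le s e : regs_le s -> nmax e <= 4 ->
  ncost s e <= 2 * nsize e * B ^ nsize e.
Proof.
move=> rs; have B0 : 0 < B by apply: leq_trans B_ge4.
have here e' : nmax e' <= 4 -> nat_len (neval s e') <= 2 * B ^ nsize e'.
  move=> h; have := neval_le rs h; have := nat_len_le (neval s e').
  have : 0 < B ^ nsize e' by rewrite expn_gt0 B0.
  lia.
elim: e => [v|x|e1 IH1 e2 IH2|e1 IH1 e2 IH2|e1 IH1 e2 IH2|e1 IH1 e2 IH2|e1 IH1 e2 IH2] h.
1,2: by rewrite [ncost _ _]/= addn0 (leq_trans (here _ h)).
all: have := here _ h; move: h; rewrite [ncost _ _]/= /= geq_max => /andP [/IH1 {}IH1 /IH2 {}IH2] h.
all: have h1 : B ^ nsize e1 <= B ^ (nsize e1 + nsize e2).+1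
       by rewrite leq_pexp2l // -addnS leq_addr.
all: have h2 : B ^ nsize e2 <= B ^ (nsize e1 + nsize e2).+1
       by rewrite leq_pexp2l // -addSn leq_addl.
all: by nia.
Qed.

Lemma ncost_small s e : regs_le s -> nsmall e -> ncost s e <= 18 * B ^ 9.
Proof.
move=> rs /andP [h9 h4]; apply: leq_trans (ncost_le rs h4) _.
apply: leq_mul; first by rewrite (leq_mul2l 2 _ 9) h9 orbT.
by rewrite leq_pexp2l //; apply: leq_trans B_ge4.
Qed.

Lemma bcost_small s b : regs_le s -> bsmall b -> bcost sz s b <= bsize b * (36 * B ^ 9).+1.
Proof.
move=> rs; elim: b => [e1 e2|e1 e2|b IH|b1 IH1 b2 IH2] //=.
- by move=> /andP [/(ncost_small rs) h1 /(ncost_small rs) h2]; lia.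
- by move=> /IH; lia.
- by move=> /andP [/IH1 h1 /IH2 h2]; nia.
Qed.

(** One bound for an assignment or a test: 288 is 8 times 36, for a test of [bsize] at most 8 with
    two expressions of cost [18 * B ^ 9] per comparison, and [Z] bounds the size of a field
    element. *)
Definition step_bound : nat := 288 * B ^ 9 + Z + 10.

Definition runs (c : cmd F) s K s' : Prop := exists2 t, t <= K & exec sz c s t s'.

Lemma runs_le c s K K' s' : K <= K' -> runs c s K s' -> runs c s K' s'.
Proof. by move=> KK [t tK E]; exists t => //; apply: leq_trans KK. Qed.

Lemma runs_NSet s x e : regs_le s -> nsmall e ->
  runs (NSet x e) s step_bound (set_nreg s x (neval s e)).
Proof.
move=> rs /(ncost_small rs) h; exists (ncost s e).+1; last exact: exec_NSet.
rewrite /step_bound; lia.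
Qed.

Lemma runs_FSet s a p e : regs_le s -> nsmall p -> fcost sz s e <= (Z + 18 * B ^ 9).+1 ->
  runs (FSet a p e) s step_bound (set_fmem s a (neval s p) (feval s e)).
Proof.
move=> rs /(ncost_small rs) h1 h2.
exists (ncost s p + fcost sz s e).+1; last exact: exec_FSet.
rewrite /step_bound; lia.
Qed.

Lemma runs_Seq c1 c2 s s1 s2 K1 K2 :
  runs c1 s K1 s1 -> runs c2 s1 K2 s2 -> runs (Seq c1 c2) s (K1 + K2) s2.
Proof.
move=> [t1 h1 E1] [t2 h2 E2]; exists (t1 + t2); first exact: leq_add.
exact: exec_Seq E1 E2.
Qed.

Lemma bcost_step s b : regs_le s -> bsmall b -> bsize b <= 8 -> bcost sz s b <= step_bound.
Proof. by move=> rs /(bcost_small rs) h h8; rewrite /step_bound; nia. Qed.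

Lemma runs_If s s' b c1 c2 K : regs_le s -> bsmall b -> bsize b <= 8 ->
  runs (if beval s b then c1 else c2) s K s' ->
  runs (If b c1 c2) s (step_bound + K) s'.
Proof.
move=> rs hb h8; case: ifP => Eb [t tK E]; exists (bcost sz s b + t).
- exact: leq_add (bcost_step rs hb h8) tK.
- exact: exec_If_true.
- exact: leq_add (bcost_step rs hb h8) tK.
- by apply: exec_If_false; rewrite ?Eb.
Qed.

(* [Inv k s]: the loop is in state [s] with [k] rounds to go. *)
Lemma runs_While b c K (Inv : nat -> state F -> Prop) :
  (forall k s, Inv k s -> beval s b = (0 < k) /\ bcost sz s b <= step_bound) ->
  (forall k s, Inv k.+1 s -> exists2 s', runs c s K s' & Inv k s') ->
  forall k s, Inv k s ->
  exists2 s', runs (While b c) s (k * (step_bound + K) + step_bound) s' & Inv 0 s'.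
Proof.
move=> Ib Ic; elim=> [|k IH] s Is; have [Eb hb] := Ib _ _ Is.
  by exists s => //; exists (bcost sz s b); rewrite ?add0n //; apply: exec_While_false; rewrite Eb.
have [s1 [t1 h1 E1] Is1] := Ic _ _ Is; have [s2 [t2 h2 E2] Is2] := IH _ Is1.
exists s2 => //; exists (bcost sz s b + t1 + t2); first by lia.
by apply: exec_While_true E1 E2; rewrite Eb.
Qed.

Lemma regs_le_set s x val : regs_le s -> val <= B -> regs_le (set_nreg s x val).
Proof. by move=> rs h y /=; case: ifP. Qed.

End Cost.

(** * The program *)

Section Program.
Variables (F : fieldType) (sz : F -> nat).

Definition BLt (e1 e2 : nexp) : bexp F := BLeq (NAdd e1 (NConst 1)) e2.
Definition BEqN (e1 e2 : nexp) : bexp F := BAnd (BLeq e1 e2) (BLeq e2 e1).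

(* Registers: 4 = u, 5 = v, 6 = M, 7 and 8 = second and third dimension of the
   output, 9 = number of output cells, 10 = current cell, 11, 12, 13 = its
   three coordinates. *)
Definition put (e : fexp F) : cmd F := FSet 1 (NReg 10) e.
Definition put_bool (b : bexp F) : cmd F := If b (put (FConst 1%R)) (put (FConst 0%R)).

(** The cases are the last slice, the rows of the padded input, and below them a unit slice or the
    shift slice. The shift test is [b - l = (a - M) + 1] rearranged to avoid truncated
    subtraction. *)
Definition write_cell : cmd F :=
  If (BLeq (NReg 4) (NReg 11))
    (put_bool (BAnd (BLt (NReg 12) (NReg 6))
                    (BEqN (NReg 13) (NAdd (NReg 2) (NAdd (NReg 5) (NReg 12))))))
    (If (BLt (NReg 12) (NReg 6))
       (If (BAnd (BLt (NReg 11) (NReg 0))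
                 (BAnd (BLt (NReg 12) (NReg 1)) (BLt (NReg 13) (NReg 2))))
          (put (FLoad 0 (NAdd (NMul (NAdd (NMul (NReg 11) (NReg 1)) (NReg 12)) (NReg 2))
                           (NReg 13))))
          (put (FConst 0%R)))
       (If (BLt (NReg 11) (NReg 5))
          (put_bool (BAnd (BEqN (NReg 12) (NAdd (NReg 6) (NReg 11)))
                          (BEqN (NReg 13) (NAdd (NReg 2) (NReg 11)))))
          (put_bool (BAnd (BEqN (NAdd (NReg 13) (NReg 6))
                              (NAdd (NAdd (NReg 2) (NReg 12)) (NConst 1)))
                          (BLt (NReg 13) (NAdd (NReg 2) (NReg 5))))))).

Definition loop_body : cmd F :=
  Seq (NSet 11 (NDiv (NDiv (NReg 10) (NReg 8)) (NReg 7)))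
  (Seq (NSet 12 (NMod (NDiv (NReg 10) (NReg 8)) (NReg 7)))
  (Seq (NSet 13 (NMod (NReg 10) (NReg 8)))
  (Seq write_cell (NSet 10 (NAdd (NReg 10) (NConst 1)))))).

(** [ku] and [kv] are the excess of [u] and [v] over [n]. Registers 0 to 2 are overwritten only at
    the end, as the loop reads the input format from them. *)
Definition reduction_program (ku kv : nat) : cmd F :=
  Seq (NSet 4 (NAdd (NReg 0) (NConst ku)))
  (Seq (NSet 5 (NAdd (NReg 0) (NConst kv)))
  (Seq (NSet 6 (NAdd (NReg 1) (NAdd (NAdd (NReg 2) (NReg 5)) (NConst 1))))
  (Seq (NSet 7 (NAdd (NReg 6) (NReg 5)))
  (Seq (NSet 8 (NAdd (NReg 2) (NAdd (NReg 5) (NReg 6))))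
  (Seq (NSet 9 (NMul (NMul (NAdd (NReg 4) (NConst 1)) (NReg 7)) (NReg 8)))
  (Seq (While (BLt (NReg 10) (NReg 9)) loop_body)
  (Seq (NSet 0 (NAdd (NReg 4) (NConst 1)))
  (Seq (NSet 1 (NReg 7)) (NSet 2 (NReg 8)))))))))).

(* The booleans are kept in the form to which [beval] evaluates. *)
Definition cell (n m l u v M : nat) (g : nat -> F) (p a b : nat) : F :=
  if u <= p then
    if (a + 1 <= M) && ((b <= l + (v + a)) && (l + (v + a) <= b)) then 1%R else 0%R
  else if a + 1 <= M then
    if (p + 1 <= n) && ((a + 1 <= m) && (b + 1 <= l)) then g ((p * m + a) * l + b)
    else 0%R
  else if p + 1 <= v then
    if ((a <= M + p) && (M + p <= a)) && ((b <= l + p) && (l + p <= b))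
    then 1%R else 0%R
  else
    if ((b + M <= l + a + 1) && (l + a + 1 <= b + M)) && (b + 1 <= l + v)
    then 1%R else 0%R.

Variables (B Z : nat).
Hypothesis B_ge4 : 4 <= B.
Hypotheses (sz0 : sz 0%R <= Z) (sz1 : sz 1%R <= Z).

Let W := step_bound B Z.

(** Every path makes at most four tests and one assignment, hence the factor 5. *)
Lemma write_cell_runs (s : state F) : regs_le B s ->
  (forall q, sz (fmem s 0 q) <= Z) ->
  runs sz write_cell s (5 * W)
    (set_fmem s 1 (nreg s 10)
      (cell (nreg s 0) (nreg s 1) (nreg s 2) (nreg s 4) (nreg s 5) (nreg s 6)
            (fmem s 0) (nreg s 11) (nreg s 12) (nreg s 13))).
Proof.
move=> rs hz.
have If_ b c1 c2 K s' : bsmall b -> bsize b <= 8 ->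
    runs sz (if beval s b then c1 else c2) s (K * W) s' ->
    runs sz (If b c1 c2) s (K.+1 * W) s'.
  by move=> hb h8 h; rewrite mulSn; apply: runs_If.
have put_ e : fcost sz s e <= (Z + 18 * B ^ 9).+1 ->
    runs sz (put e) s (1 * W) (set_fmem s 1 (nreg s 10) (feval s e)).
  by move=> he; rewrite mul1n; apply: (@runs_FSet F sz B Z B_ge4 s 1 (NReg 10)).
have up K K' c s' : K <= K' -> runs sz c s (K * W) s' -> runs sz c s (K' * W) s'.
  by move=> KK; apply: runs_le; rewrite leq_mul2r KK orbT.
have put1 : runs sz (put (FConst 1%R)) s (1 * W) (set_fmem s 1 (nreg s 10) 1%R).
  by apply: (put_ (FConst 1%R)); rewrite /= addn0; lia.
have put0 : runs sz (put (FConst 0%R)) s (1 * W) (set_fmem s 1 (nreg s 10) 0%R).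
  by apply: (put_ (FConst 0%R)); rewrite /= addn0; lia.
have load_ e : nsmall e -> fcost sz s (FLoad 0 e) <= (Z + 18 * B ^ 9).+1.
  by move=> he; rewrite /= -addSn leq_add ?ltnS //; apply: ncost_small.
rewrite /write_cell /cell; apply: (If_) => //; rewrite /=.
case: ifP => _.
  by apply: (up 2) => //; apply: (If_) => //; rewrite [beval _ _]/=; case: ifP.
apply: (If_) => //; rewrite [beval _ _]/=; case: ifP => _.
  apply: (If_) => //; rewrite [beval _ _]/=; case: ifP => _; apply: (up 1) => //.
  by set e := FLoad _ _; apply: (put_ e); apply: load_.
apply: (If_) => //; rewrite [beval _ _]/=; case: ifP => _.
  by apply: (If_ _ _ _ 1) => //; rewrite [beval _ _]/=; case: ifP.
by apply: (If_ _ _ _ 1) => //; rewrite [beval _ _]/=; case: ifP.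
Qed.


(** * Execution of the loop and of the whole program *)

Section Run.
Variables (n m l u v : nat).
Let M := m + (l + v).+1.
Let m' := M + v.
Let l' := l + (v + M).
Let tot := (u + 1) * m' * l'.
Variable g : nat -> F.
Hypothesis sz_g : forall q, sz (g q) <= Z.
Hypotheses (n_le : n <= B) (m_le : m <= B) (l_le : l <= B) (u_le : u + 1 <= B)
  (v_le : v <= B) (M_le : M <= B) (m'_le : m' <= B) (l'_le : l' <= B) (tot_le : tot <= B).

Definition output_cell (q : nat) : F :=
  cell n m l u v M g (q %/ l' %/ m') (q %/ l' %% m') (q %% l').

(** Registers 11 to 13 are recomputed in each round and only need to stay bounded. The 0 in position
    3 records that no failure is reported. *)
Definition loop_inv (k : nat) (s : state F) : Prop :=
  exists2 q, q + k = tot &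
  [/\ forall x, x < 11 -> nreg s x = nth 0 [:: n; m; l; 0; u; v; M; m'; l'; tot; q] x,
      regs_le B s, forall p, fmem s 0 p = g p
    & forall p, p < q -> fmem s 1 p = output_cell p].

Lemma loop_body_runs k s : loop_inv k.+1 s ->
  exists2 s', runs sz loop_body s (9 * W) s' & loop_inv k s'.
Proof.
move=> [q qk [rE rs gE oE]].
have q_le : q <= B by apply: leq_trans tot_le; rewrite -qk leq_addr.
pose s1 := set_nreg s 11 (q %/ l' %/ m').
pose s2 := set_nreg s1 12 (q %/ l' %% m').
pose s3 := set_nreg s2 13 (q %% l').
pose s4 := set_fmem s3 1 q (output_cell q).
pose s5 := set_nreg s4 10 (q + 1).
have rs1 : regs_le B s1.
  by apply: regs_le_set => //; rewrite (leq_trans (leq_div _ _)) // (leq_trans (leq_div _ _)).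
have rs2 : regs_le B s2.
  by apply: regs_le_set => //; rewrite (leq_trans (leq_mod _ _)) // (leq_trans (leq_div _ _)).
have rs3 : regs_le B s3.
  by apply: regs_le_set => //; rewrite (leq_trans (leq_mod _ _)).
have E1 : runs sz (NSet 11 (NDiv (NDiv (NReg 10) (NReg 8)) (NReg 7))) s W s1.
  have := @runs_NSet F sz B Z B_ge4 s 11 (NDiv (NDiv (NReg 10) (NReg 8)) (NReg 7)) rs isT.
  by rewrite /= !rE.
have E2 : runs sz (NSet 12 (NMod (NDiv (NReg 10) (NReg 8)) (NReg 7))) s1 W s2.
  have := @runs_NSet F sz B Z B_ge4 s1 12 (NMod (NDiv (NReg 10) (NReg 8)) (NReg 7)) rs1 isT.
  by rewrite /= !rE.
have E3 : runs sz (NSet 13 (NMod (NReg 10) (NReg 8))) s2 W s3.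
  have := @runs_NSet F sz B Z B_ge4 s2 13 (NMod (NReg 10) (NReg 8)) rs2 isT.
  by rewrite /= !rE.
have E4 : runs sz write_cell s3 (5 * W) s4.
  have := write_cell_runs rs3; rewrite /= !rE //= => /(_ _) H.
  have {}H := H (fun p => eq_ind_r (fun z => sz z <= Z) (sz_g p) (gE p)).
  move: H; congr (runs _ _ _ _ (set_fmem _ _ _ _)).
  by rewrite /output_cell /cell !gE.
have rs4 : regs_le B s4 by [].
have E5 : runs sz (NSet 10 (NAdd (NReg 10) (NConst 1))) s4 W s5.
  have := @runs_NSet F sz B Z B_ge4 s4 10 (NAdd (NReg 10) (NConst 1)) rs4 isT.
  by rewrite /= !rE.
exists s5.
  apply: runs_le (runs_Seq E1 (runs_Seq E2 (runs_Seq E3 (runs_Seq E4 E5)))).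
  by lia.
exists (q + 1); first by rewrite -qk addn1 addSnnS.
split.
- by do 11 (case=> [_|]; first by rewrite /= ?rE).
- by apply: regs_le_set => //; apply: leq_trans tot_le; rewrite -qk leq_add2l.
- by move=> p /=; apply: gE.
- move=> p; rewrite addn1 ltnS /= => pq; have [->//|pnq] := eqVneq p q.
  by apply: oE; rewrite ltn_neqAle pnq.
Qed.

Lemma loop_runs s : loop_inv tot s ->
  exists2 s', runs sz (While (BLt (NReg 10) (NReg 9)) loop_body) s (tot * (W + 9 * W) + W) s'
            & loop_inv 0 s'.
Proof.
apply: (runs_While B_ge4); last exact: loop_body_runs.
move=> k {}s [q qk [rE rs _ _]]; split; last exact: bcost_step.
by rewrite /= !rE //=; move: qk; case: k => [|k]; lia.
Qed.

(** Each cell takes one test and a body of nine steps. The remaining ten steps are nine assignments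
    outside the loop and the final failing test. *)
Lemma reduction_program_runs ku kv s : ku <= 4 -> kv <= 4 -> u = n + ku -> v = n + kv ->
  (forall x, nreg s x = nth 0 [:: n; m; l] x) -> (forall p, fmem s 0 p = g p) ->
  exists2 s', runs sz (reduction_program ku kv) s ((10 * tot + 10) * W) s' &
  [/\ nreg s' 0 = u + 1, nreg s' 1 = m', nreg s' 2 = l', nreg s' 3 = 0
    & forall p, p < tot -> fmem s' 1 p = output_cell p].
Proof.
move=> ku4 kv4 uE vE rE gE.
have step s0 x e val : regs_le B s0 -> nsmall e -> neval s0 e = val -> val <= B ->
    runs sz (NSet x e) s0 W (set_nreg s0 x val) /\ regs_le B (set_nreg s0 x val).
  by move=> rs0 he <- hv; split; [apply: runs_NSet | apply: regs_le_set].
have rs : regs_le B s by move=> x; rewrite rE; do 3 (case: x => [//|x]); rewrite /= nth_nil.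
have [|||E1 rs1] := step s 4 (NAdd (NReg 0) (NConst ku)) u rs.
- by rewrite /nsmall /= max0n.
- by rewrite /= rE /= uE.
- by apply: leq_trans u_le; rewrite leq_addr.
have [|||E2 rs2] := step _ 5 (NAdd (NReg 0) (NConst kv)) v rs1.
- by rewrite /nsmall /= max0n.
- by rewrite /= rE /= vE.
- by [].
have [|||E3 rs3] := step _ 6
  (NAdd (NReg 1) (NAdd (NAdd (NReg 2) (NReg 5)) (NConst 1))) M rs2 => //.
  by rewrite /= !rE /= /M addn1.
have [|||E4 rs4] := step _ 7 (NAdd (NReg 6) (NReg 5)) m' rs3 => //.
have [|||E5 rs5] := step _ 8 (NAdd (NReg 2) (NAdd (NReg 5) (NReg 6))) l' rs4 => //.
  by rewrite /= !rE.
have [|||E6 rs6] := step _ 9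
  (NMul (NMul (NAdd (NReg 4) (NConst 1)) (NReg 7)) (NReg 8)) tot rs5 => //.
set s6 := set_nreg _ 9 _ in E6 rs6.
have inv6 : loop_inv tot s6.
  exists 0; rewrite ?add0n //; split=> //.
  by do 11 (case=> [_|]; first by rewrite /= ?rE).
have [s7 E7 [q qE [r7 rs7 _ o7]]] := loop_runs inv6.
rewrite addn0 in qE; rewrite {q}qE in r7 o7.
have [|||E8 rs8] := step _ 0 (NAdd (NReg 4) (NConst 1)) (u + 1) rs7 => //.
  by rewrite /= !r7.
have [|||E9 rs9] := step _ 1 (NReg 7) m' rs8 => //; first by rewrite /= !r7.
have [|||E10 rs10] := step _ 2 (NReg 8) l' rs9 => //; first by rewrite /= !r7.
eexists.
  apply: runs_le (runs_Seq E1 (runs_Seq E2 (runs_Seq E3 (runs_Seq E4 (runs_Seq E5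
    (runs_Seq E6 (runs_Seq E7 (runs_Seq E8 (runs_Seq E9 E10))))))))).
  by lia.
by split=> //=; rewrite ?r7.
Qed.

End Run.
End Program.

(** * Agreement of the program with the reduction, and its time bound *)

Section Correctness.
Variables (F : fieldType) (sz : F -> nat).

Lemma tensor_addr_lt n m l (x : 'I_n * 'I_m * 'I_l) : tensor_addr x < n * m * l.
Proof.
case: x => [[i j] k]; rewrite /tensor_addr /=.
have lt_pack a b c d : a < b -> c < d -> a * d + c < b * d.
  move=> ab cd; apply: leq_trans (_ : a.+1 * d <= _); last by rewrite leq_mul2r ab orbT.
  by rewrite mulSn addnC ltn_add2r.
by apply: (lt_pack) => //; apply: lt_pack.
Qed.

Lemma tensor_addr_coords n m l (x : 'I_n * 'I_m * 'I_l) :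
  [/\ tensor_addr x %/ l %/ m = x.1.1, tensor_addr x %/ l %% m = x.1.2
    & tensor_addr x %% l = x.2].
Proof.
case: x => [[i j] k]; rewrite /tensor_addr /=.
have l0 : 0 < l by apply: leq_ltn_trans (ltn_ord k).
have m0 : 0 < m by apply: leq_ltn_trans (ltn_ord j).
rewrite divnMDl // (divn_small (ltn_ord k)) addn0 divnMDl // (divn_small (ltn_ord j)) addn0.
by rewrite !modnMDl !modn_small.
Qed.

Lemma tensor_addr_inj n m l : injective (@tensor_addr n m l).
Proof.
move=> x y E; have [x1 x2 x3] := tensor_addr_coords x.
have [y1 y2 y3] := tensor_addr_coords y; rewrite E in x1 x2 x3.
case: x y {E} x1 x2 x3 y1 y2 y3 => [[i j] k] [[i' j'] k'] /= -> -> ->.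
by move=> /val_inj -> /val_inj -> /val_inj ->.
Qed.

Lemma init_load n m l (A : tensor F n m l) w x :
  fmem (init_state A w) 0 (tensor_addr x) = A x.
Proof.
rewrite /=; case: pickP => [y /eqP /tensor_addr_inj -> //|/(_ x)].
by rewrite eqxx.
Qed.

(** Cells outside the input hold 0, whose size need not be covered by the input size. *)
Lemma init_sz n m l (A : tensor F n m l) w q :
  sz (fmem (init_state A w) 0 q) <= input_size sz A + sz 0%R.
Proof.
rewrite /=; case: pickP => [x _|_]; last by rewrite leq_addl.
by rewrite /input_size (bigD1 x) //=; lia.
Qed.

(** Splitting each index along the blocks of the gadget reaches one branch of [cell] at a time, and
    arithmetic on the offsets decides its tests. *)
Lemma reductionE n m l u v (A : tensor F n m l) w x : n <= u ->
  reduction u v A x =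
  cell n m l u v (m + (l + v).+1) (fmem (init_state A w) 0) x.1.1 x.1.2 x.2.
Proof.
case: x => [[p a] b] nu; rewrite ffunE /= /gadget.
case: (split_ordP p) => [i ->|j ->].
  have hi := ltn_ord i; rewrite /cell [u <= _]leqNgt hi /=.
  case: (split_ordP a) => [a1 ->|a1 ->]; have ha := ltn_ord a1;
    case: (split_ordP b) => [b1 ->|b1 ->]; have hb := ltn_ord b1.
  - rewrite block_mxEul /= addn1 ha.
    case: (split_ordP a1) => a2 Ea; rewrite Ea /=.
      rewrite col_mxEu /= !addn1 !ltn_ord andbT.
      have [iN|iN] := ltnP i n; last by rewrite extend_family_ge // mxE.
      rewrite (@extend_family_lt _ _ _ _ _ _ _ (Ordinal iN)) // mxE.
      by rewrite -(init_load A w).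
    by rewrite col_mxEd mxE; case: ifP => //; lia.
  - rewrite block_mxEur mxE /=; case: ifP => [_|]; last by lia.
    by case: ifP => //; lia.
  - rewrite block_mxEdl mxE /=; case: ifP => [|_]; first by lia.
    by case: ifP => _; case: ifP => //; lia.
  - rewrite block_mxEdr /=; case: ifP => [|_]; first by lia.
    case: (split_ordP b1) => b2 ->; rewrite ?row_mxEl ?row_mxEr /= mxE; have hb2 := ltn_ord b2.
      rewrite addn1; case: (ltnP i v) => iv; case: ifP => h.
      - by have -> : (a1 == i :> nat) && (b2 == i :> nat) by lia.
      - by have -> : (a1 == i :> nat) && (b2 == i :> nat) = false by lia.
      - by have -> : b2 == a1.+1 :> nat by lia.
      - by have -> : (b2 == a1.+1 :> nat) = false by lia.
    by case: ifP => _; case: ifP => //; lia.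
have -> : (rshift u j : nat) = u by rewrite /= ord1 addn0.
rewrite /cell leqnn.
case: (split_ordP a) => [a1 ->|a1 ->]; have ha := ltn_ord a1;
  case: (split_ordP b) => [b1 ->|b1 ->]; have hb := ltn_ord b1.
- by rewrite block_mxEul mxE /=; case: ifP => //; lia.
- rewrite block_mxEur /=; case: (split_ordP b1) => b2 ->; have hb2 := ltn_ord b2.
    by rewrite row_mxEl mxE /=; case: ifP => //; lia.
  rewrite row_mxEr mxE /= -val_eqE /=; case: ifP => h.
    by have -> : a1 == b2 :> nat by lia.
  by have -> : (a1 == b2 :> nat) = false by lia.
- by rewrite block_mxEdl mxE /=; case: ifP => //; lia.
- by rewrite block_mxEdr mxE /=; case: ifP => //; lia.
Qed.


Lemma reduction_program_correct ku kv : ku <= 4 -> kv <= 4 ->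
  exists c d, forall n m l u v (A : tensor F n m l) w, u = n + ku -> v = n + kv ->
  exists t s, [/\ exec sz (reduction_program F ku kv) (init_state A w) t s,
    t <= c * (input_size sz A).+1 ^ d, ~~ reports_failure s
    & outputs s (reduction u v A)].
Proof.
move=> ku4 kv4.
(* [C] stands for the factor 1000 in the number of output cells; as a variable it keeps powers such
   as [C ^ 10] symbolic. *)
have [C hC] : exists C, 1000 <= C by exists 1000.
(* At most [20 * B] steps are made, each costing a constant times [B ^ 9], and [B ^ 10] is [C ^ 10]
   times the 30th power of [I]. *)
exists (20 * (299 + sz 0%R + sz 1%R) * C ^ 10), (3 * 10) => n m l u v A w uE vE.
set I := (input_size sz A).+1.
have I_ge : n + m + l < I by rewrite ltnS leq_addr.
pose B := C * I ^ 3; pose Z := I + sz 0%R + sz 1%R.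
have I0 : 0 < I by [].
have I_le : I <= I ^ 3 by rewrite -{1}[I]expn1 leq_pexp2l.
have lin x : x <= 10 * I -> x <= B.
  by move=> hx; apply: leq_trans hx _; apply: leq_mul => //; apply: leq_trans hC.
have hu : u + 1 <= 10 * I by lia.
have hv : v <= 10 * I by lia.
have hM : m + (l + v).+1 <= 10 * I by lia.
have hm' : m + (l + v).+1 + v <= 10 * I by lia.
have hl' : l + (v + (m + (l + v).+1)) <= 10 * I by lia.
have htot : (u + 1) * (m + (l + v).+1 + v) * (l + (v + (m + (l + v).+1))) <= B.
  apply: leq_trans (leq_mul (leq_mul hu hm') hl') _.
  have -> : 10 * I * (10 * I) * (10 * I) = 1000 * I ^ 3 by rewrite !expnS expn0; lia.
  by rewrite leq_mul2r hC orbT.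
have B4 : 4 <= B by apply: lin; lia.
have sz0Z : sz 0%R <= Z by rewrite /Z; lia.
have sz1Z : sz 1%R <= Z by rewrite /Z; lia.
have szg q : sz (fmem (init_state A w) 0 q) <= Z.
  by apply: leq_trans (init_sz A w q) _; rewrite /Z /I; lia.
have nB : n <= B by apply: lin; lia.
have mB : m <= B by apply: lin; lia.
have lB : l <= B by apply: lin; lia.
have [s [t ht E] [r0 r1 r2 r3 oE]] := @reduction_program_runs F sz B Z B4 sz0Z sz1Z
  n m l u v _ szg nB mB lB (lin _ hu) (lin _ hv) (lin _ hM) (lin _ hm') (lin _ hl') htot
  ku kv (init_state A w) ku4 kv4 uE vE (fun _ => erefl) (fun _ => erefl).
exists t, s; split=> //; last 1 first.
- split=> // x; rewrite oE ?tensor_addr_lt // (@reductionE n m l u v A w) ?uE ?leq_addr //.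
  rewrite -?uE /output_cell; have [e1 e2 e3] := tensor_addr_coords x.
  by rewrite e1 e2 e3.
- apply: leq_trans ht _; rewrite expnM -[leqRHS]mulnA -expnMn -/B.
  have B9 : 0 < B ^ 9 by rewrite expn_gt0 (leq_trans _ B4).
  have BB9 : B <= B ^ 9 by rewrite -{1}[B]expn1 leq_pexp2l // (leq_trans _ B4).
  have IB : I <= B by apply: lin; lia.
  (* 299 is 288 + 10 + 1, the last summand accounting for [I] inside [Z]. *)
  have hW : step_bound B Z <= (299 + sz 0%R + sz 1%R) * B ^ 9.
    have h0 : sz 0%R <= sz 0%R * B ^ 9 by rewrite leq_pmulr.
    have h1 : sz 1%R <= sz 1%R * B ^ 9 by rewrite leq_pmulr.
    rewrite /step_bound /Z !mulnDl; move: (B ^ 9) (leq_trans IB BB9) B9 h0 h1 => P.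
    by move: (_ * P) (_ * P) => x y; clear; lia.
  rewrite [B ^ 10]expnS mulnACA; apply: leq_mul hW.
  by move: htot B4; clear; lia.
- by rewrite /reports_failure r3.
Qed.

End Correctness.

Theorem theorem1p15 (F : fieldType) (sz : F -> nat) :
  (exists (n' m' l' : nat -> nat -> nat -> nat) (f : tensor_map F n' m' l'),
    [/\ polytime_computable sz f,
        forall (n m l : nat) (A B : tensor F n m l),
          tensor_isomorphic (Mon F n) (GL F m) (GL F l) A B <->
          tensor_isomorphic (GL F (n' n m l)) (GL F (m' n m l))
            (GL F (l' n m l)) (f n m l A) (f n m l B)
      & [/\ linearly_bounded n', linearly_bounded m' & linearly_bounded l']])
  /\
  (exists (n' m' l' : nat -> nat -> nat -> nat) (f : tensor_map F n' m' l'),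
    [/\ las_vegas_polytime_computable sz f,
        forall (n m l : nat) (A B : tensor F n m l),
          tensor_isomorphic (Diag F n) (GL F m) (GL F l) A B <->
          tensor_isomorphic (GL F (n' n m l)) (GL F (m' n m l))
            (GL F (l' n m l)) (f n m l A) (f n m l B)
      & [/\ linearly_bounded n', linearly_bounded m' & linearly_bounded l']]).
Proof.
split.
  exists _, _, _, (fun n m l A => reduction n n A); split.
  - have [c [d H]] := reduction_program_correct sz (leq0n 4) (leq0n 4).
    exists (reduction_program F 0 0), c, d => n m l A.
    have [t [s [E ht _ out]]] := H n m l n n A [::] (esym (addn0 n)) (esym (addn0 n)).
    by exists t, s.
  - exact: reduction_Mon.
  - by split; exists 10 => n m l; lia.
exists _, _, _, (fun n m l A => reduction n.+4 n.+3 A); split.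
- have [c [d H]] := reduction_program_correct sz (leqnn 4) (leqnSn 3).
  exists (reduction_program F 4 3), c, d => n m l A T.
  (* The program draws no coins and never fails, so every coin sequence is good. *)
  exists setT; split; first by rewrite cardsT card_tuple card_bool leq_pmull.
  move=> w.
  have [t [s [E ht nf out]]] := H n m l n.+4 n.+3 A w (esym (addn4 n)) (esym (addn3 n)).
  by exists t, s; split=> //; rewrite inE.
- exact: reduction_Diag.
(* The dimensions are at most twice the total plus 7, and the additive constant is absorbed because
   the total is positive. *)
- by split; exists 20 => n m l; lia.
Qed.
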